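(* C-Cons-Add (under the Plurality rule) with a symmetric bundling function, maximum bundle size three, and two candidates can be solved in $O(|W|^5)$ time, where $|W|$ is the number of unregistered voters.
   Context: An election $(C,V)$: finite candidate set $C$, finite voter set $V$, each voter with one favorite candidate; $s_c(X)$ is the number of voters in $X$ with favorite $c$; $c$ is a (Plurality) winner if $s_c(V)\ge s_{c'}(V)$ for all $c'$. A bundling function on $W$ is $\kappa:W\to2^W$ with $w\in\kappa(w)$; $\kappa(W')=\bigcup_{w\in W'}\kappa(w)$; maximum bundle size is $\max_w|\kappa(w)|$; symmetric means for distinct $x,y$: $y\in\kappa(x)$ iff $x\in\kappa(y)$. C-Cons-Add: given an election $(C,V)$, unregistered voters $W$ with $V\cap W=\emptyset$, $\kappa:W\to2^W$, $p\in C$ and $k\in\mathbb{N}$, decide whether some $W'\subseteq W$ with $|W'|\le k$ makes $p$ a winner of $(C,V\cup\kappa(W'))$. *)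

(* Defs.v *)
From mathcomp Require Import all_boot.
Set Implicit Arguments. Unset Strict Implicit. Unset Printing Implicit Defensive.

(* Voters are drawn from a finite universe Vt; each voter x has a       *)
(* favorite candidate fav x.  V and W are finite sets of voters.        *)
Section Election.
Variables (C Vt : finType) (fav : Vt -> C).

Definition score (c : C) (X : {set Vt}) : nat := #|[set x in X | fav x == c]|.

Definition plurality_winner (X : {set Vt}) (c : C) : Prop :=
  forall c' : C, score c' X <= score c X.

Definition bundling_on (W : {set Vt}) (kappa : Vt -> {set Vt}) : Prop :=
  forall w, w \in W -> w \in kappa w /\ kappa w \subset W.

Definition bundle_union (kappa : Vt -> {set Vt}) (W' : {set Vt}) : {set Vt} :=
  \bigcup_(w in W') kappa w.

Definition max_bundle_size_le (W : {set Vt}) (kappa : Vt -> {set Vt}) (b : nat) : Prop :=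
  forall w, w \in W -> #|kappa w| <= b.

Definition symmetric_bundling (W : {set Vt}) (kappa : Vt -> {set Vt}) : Prop :=
  forall x y, x \in W -> y \in W -> x != y -> (y \in kappa x <-> x \in kappa y).

Definition CConsAdd (V W : {set Vt}) (kappa : Vt -> {set Vt}) (p : C) (k : nat) : Prop :=
  exists W' : {set Vt}, [/\ W' \subset W, #|W'| <= k &
     plurality_winner (V :|: bundle_union kappa W') p].

End Election.

(* Machine model: unit-cost RAM with unbounded natural-number registers *)
(* and memory; instructions: constant, addition, truncated subtraction, *)
(* indirect load/store, conditional/unconditional jump, halt.           *)
(* Each executed instruction costs one step.                            *)
Inductive instr :=
| IConst of nat & nat
| IAdd   of nat & nat & nat
| ISub   of nat & nat & nat
| ILoad  of nat & nat
| IStore of nat & nat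
| IJz    of nat & nat
| IJmp   of nat
| IHalt.

Record ram_state := RamSt { pc : nat; reg : nat -> nat; mem : nat -> nat }.

Definition upd (f : nat -> nat) (i v : nat) : nat -> nat :=
  fun j => if j == i then v else f j.

(* One step; None when the machine has halted (IHalt or pc out of range). *)
Definition ram_step (P : seq instr) (s : ram_state) : option ram_state :=
  let: RamSt l r m := s in
  match nth IHalt P l with
  | IConst d c => Some (RamSt l.+1 (upd r d c) m)
  | IAdd d a b => Some (RamSt l.+1 (upd r d (r a + r b)) m)
  | ISub d a b => Some (RamSt l.+1 (upd r d (r a - r b)) m)
  | ILoad d a => Some (RamSt l.+1 (upd r d (m (r a))) m)
  | IStore a x => Some (RamSt l.+1 r (upd m (r a) (r x)))
  | IJz x l' => Some (RamSt (if r x == 0 then l' else l.+1) r m)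
  | IJmp l' => Some (RamSt l' r m)
  | IHalt => None
  end.

Fixpoint ram_run (P : seq instr) (t : nat) (s : ram_state) : option ram_state :=
  match ram_step P s with
  | None => Some s
  | Some s' => if t is t'.+1 then ram_run P t' s' else None
  end.

Definition ram_init (input : nat -> nat) : ram_state := RamSt 0 (fun _ => 0) input.

(* Input encoding of a two-candidate C-Cons-Add instance.               *)
(* W is listed as ws := enum W, voter ws_i gets index i.                *)
(*   M[0] = |W|, M[1] = k, M[2] = s_p(V), M[3] = |V| - s_p(V)           *)
(*          (= s_q(V) for the other candidate q when |C| = 2),          *)
(*   for i < |W|:  M[4+4i]   = 1 if fav ws_i = p else 0,                *)
(*                 M[4+4i+1+j] (j < 3) = 1 + index of the j-th member   *)
(*                 of kappa(ws_i), or 0 if kappa(ws_i) has <= j members.*)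
(*   all other cells are 0.                                             *)
Definition encode (C Vt : finType) (fav : Vt -> C) (V W : {set Vt})
    (kappa : Vt -> {set Vt}) (p : C) (k : nat) : nat -> nat :=
  let ws := enum W in
  let n := size ws in
  let favs := [seq nat_of_bool (fav x == p) | x <- ws] in
  let bund := [seq [seq (index y ws).+1 | y <- enum (kappa x)] | x <- ws] in
  fun i =>
    if i == 0 then n else
    if i == 1 then k else
    if i == 2 then score fav p V else
    if i == 3 then #|V| - score fav p V else
    let j := i - 4 in
    let w := j %/ 4 in
    let slot := j %% 4 in
    if w < n then
      (if slot == 0 then nth 0 favs w else nth 0 (nth [::] bund w) slot.-1)
    else 0.

Definition ram_decides_within (P : seq instr) (input : nat -> nat) (t : nat)
    (answer : Prop) : Prop :=
  exists s, ram_run P t (ram_init input) = Some s /\ (reg s 0 != 0 <-> answer).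

(* Main.v *)
Require Import Defs.
From mathcomp Require Import all_boot.
From mathcomp Require Import zify ring.

(** Symmetric bundles of size at most three are the closed neighbourhoods of a
    graph of maximum degree two.  A breadth-first enumeration of such a graph
    never holds more than two discovered but unprocessed vertices, so adjacent
    vertices are at distance at most two in it.  Whether the voter at position
    [m] is covered thus depends only on the choices at positions [m - 2], ...,
    [m + 2], and dynamic programming over the last four choices and the
    remaining budget maximises the sum over [W] of [2] for each covered
    supporter of [p], [0] for each other covered voter, and [1] for each
    uncovered voter; this sum exceeds [#|W|] by the lead that [p] gains.
    On the RAM this takes quadratic time: the program is compiled from a
    language in which every loop runs [n + b] times for a literal [b], so that
    its cost is a polynomial in [n] of degree the nesting depth of loops. *)

Set Implicit Arguments.
Unset Strict Implicit.
Unset Printing Implicit Defensive.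

(** * A language of counted loops and its compilation *)

Inductive exp :=
| Var of nat
| Cst of nat
| Sz
| Add of exp & exp
| Sub of exp & exp
| Get of nat & exp.

(* [Get a e] reads cell [4 * e + a]: memory is a table with four columns, whose
   rows [1], ..., [n] are the voters in the encoding and row [0] its header.
   [Put a e1 e2] writes to row [n + 1 + e1], so the input stays intact. *)
Inductive com :=
| Skip
| Set_ of nat & exp
| Put of nat & exp & exp
| Seq of com & com
| If of exp & com & com
| For of nat & nat & com.

Record store := Store { rg : nat -> nat; mm : nat -> nat }.

Definition setr (s : store) (x v : nat) := Store (upd (rg s) x v) (mm s).

Fixpoint ev (n : nat) (s : store) (e : exp) : nat :=
  match e with
  | Var x => rg s x
  | Cst c => c
  | Sz => n
  | Add e1 e2 => ev n s e1 + ev n s e2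
  | Sub e1 e2 => ev n s e1 - ev n s e2
  | Get a e1 => mm s (4 * ev n s e1 + a)
  end.

Fixpoint eval (n : nat) (c : com) (s : store) : store :=
  match c with
  | Skip => s
  | Set_ x e => setr s x (ev n s e)
  | Put a e1 e2 =>
      Store (rg s) (upd (mm s) (4 * (n + 1 + ev n s e1) + a) (ev n s e2))
  | Seq c1 c2 => eval n c2 (eval n c1 s)
  | If e c1 c2 => if ev n s e != 0 then eval n c1 s else eval n c2 s
  | For x b c1 => iteri (n + b) (fun i s' => eval n c1 (setr s' x i)) s
  end.

(* Program register [x] is machine register [2 x]; the odd machine registers
   hold loop counters and intermediate values. *)
Definition hid d := d.*2.+1.

(** The value ends up in [hid d], and no hidden register below [d] is touched. There is no move
    instruction, so copies are made by adding a zero; [Sz] is read from memory cell [0]. *)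
Fixpoint cexp (e : exp) (d : nat) : seq instr :=
  match e with
  | Var x => [:: IConst (hid d) 0; IAdd (hid d) x.*2 (hid d)]
  | Cst c => [:: IConst (hid d) c]
  | Sz => [:: IConst (hid d) 0; ILoad (hid d) (hid d)]
  | Add e1 e2 => cexp e1 d ++ cexp e2 d.+1 ++ [:: IAdd (hid d) (hid d) (hid d.+1)]
  | Sub e1 e2 => cexp e1 d ++ cexp e2 d.+1 ++ [:: ISub (hid d) (hid d) (hid d.+1)]
  | Get a e1 => cexp e1 d ++
      [:: IAdd (hid d) (hid d) (hid d); IAdd (hid d) (hid d) (hid d);
          IConst (hid d.+1) a; IAdd (hid d) (hid d) (hid d.+1);
          ILoad (hid d) (hid d)]
  end.

(** Jumps are absolute, so the address [o] of the code is a parameter. A loop keeps its counter in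
    [hid d], compiles its body at depth [d.+1], and recomputes the bound [n + b] before every test
    at address [o + 1]. *)
Fixpoint ccom (c : com) (o d : nat) : seq instr :=
  match c with
  | Skip => [::]
  | Set_ x e => cexp e d ++ [:: IConst (hid d.+1) 0; IAdd x.*2 (hid d) (hid d.+1)]
  | Put a e1 e2 => cexp e1 d ++ cexp e2 d.+1 ++
      [:: IConst (hid d.+2) 0; ILoad (hid d.+2) (hid d.+2);
          IAdd (hid d) (hid d.+2) (hid d);
          IConst (hid d.+2) 1; IAdd (hid d) (hid d) (hid d.+2);
          IAdd (hid d) (hid d) (hid d); IAdd (hid d) (hid d) (hid d);
          IConst (hid d.+2) a; IAdd (hid d) (hid d) (hid d.+2);
          IStore (hid d) (hid d.+1)]
  | Seq c1 c2 => let p1 := ccom c1 o d in p1 ++ ccom c2 (o + size p1) d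
  | If e c1 c2 =>
      let p0 := cexp e d in
      let p1 := ccom c1 (o + size p0 + 1) d in
      let o2 := o + size p0 + 1 + size p1 + 1 in
      let p2 := ccom c2 o2 d in
      p0 ++ [:: IJz (hid d) o2] ++ p1 ++ [:: IJmp (o2 + size p2)] ++ p2
  | For x b c1 =>
      let p1 := ccom c1 (o + 9) d.+1 in
      [:: IConst (hid d) 0;
          IConst (hid d.+1) 0; ILoad (hid d.+1) (hid d.+1);
          IConst (hid d.+2) b; IAdd (hid d.+1) (hid d.+1) (hid d.+2);
          ISub (hid d.+1) (hid d.+1) (hid d);
          IJz (hid d.+1) (o + 9 + size p1 + 3);
          IConst (hid d.+1) 0; IAdd x.*2 (hid d) (hid d.+1)] ++ p1 ++
      [:: IConst (hid d.+1) 1; IAdd (hid d) (hid d) (hid d.+1); IJmp (o + 1)]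
  end.

(** An upper bound: a conditional is charged for both branches. Each pass of a loop adds [8]
    instructions before the body and [3] after it; the initialisation and the final failing test add
    [1 + 6]. *)
Fixpoint cost (n : nat) (c : com) : nat :=
  match c with
  | Skip => 0
  | Set_ x e => size (cexp e 0) + 2
  | Put a e1 e2 => size (cexp e1 0) + size (cexp e2 0) + 10
  | Seq c1 c2 => cost n c1 + cost n c2
  | If e c1 c2 => size (cexp e 0) + 2 + cost n c1 + cost n c2
  | For x b c1 => (n + b) * (cost n c1 + 11) + 7
  end.

(** * Correctness and cost of the compiled code *)

Lemma size_cexp e d : size (cexp e d) = size (cexp e 0).
Proof. by elim: e d => //= [e1 IH1 e2 IH2|e1 IH1 e2 IH2|a e1 IH1] d;
  rewrite !size_cat /= IH1 ?(IH2 d.+1) ?(IH2 1). Qed.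

Definition code_at (P : seq instr) (o : nat) (q : seq instr) :=
  forall k, k < size q -> nth IHalt P (o + k) = nth IHalt q k.

Lemma code_at_cat P o q1 q2 :
  code_at P o (q1 ++ q2) -> code_at P o q1 /\ code_at P (o + size q1) q2.
Proof.
move=> H; split=> k hk.
  by rewrite H ?nth_cat ?hk // size_cat ltn_addr.
rewrite -addnA H ?size_cat ?ltn_add2l // nth_cat.
by rewrite ltnNge leq_addr /= addKn.
Qed.

Lemma code_at_cons P o i q :
  code_at P o (i :: q) -> nth IHalt P o = i /\ code_at P o.+1 q.
Proof.
move=> H; split; first by rewrite -[o]addn0 H.
by move=> k hk; rewrite addSnnS H.
Qed.

(** Quantifying over the fuel [t'] left for the continuation lets runs be composed without any
    halting condition. *)
Definition runs (P : seq instr) (b : nat) (s s' : ram_state) :=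
  exists2 t, t <= b & forall t', ram_run P (t + t') s = ram_run P t' s'.

Lemma runs_refl P s : runs P 0 s s.
Proof. by exists 0. Qed.

Lemma runs_pc P a b r m : a = b -> runs P 0 (RamSt a r m) (RamSt b r m).
Proof. by move=> ->; exact: runs_refl. Qed.

Lemma runs_trans P b1 b2 s1 s2 s3 :
  runs P b1 s1 s2 -> runs P b2 s2 s3 -> runs P (b1 + b2) s1 s3.
Proof.
move=> [t1 h1 H1] [t2 h2 H2]; exists (t1 + t2); first exact: leq_add.
by move=> t'; rewrite -addnA H1 H2.
Qed.

Lemma runs_step P b s1 s2 s3 :
  ram_step P s1 = Some s2 -> runs P b s2 s3 -> runs P b.+1 s1 s3.
Proof.
move=> H1 [t ht H2]; exists t.+1 => // t'.
by rewrite addSn /= H1 H2.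
Qed.

Lemma runs_leq P b b' s s' : b <= b' -> runs P b s s' -> runs P b' s s'.
Proof. by move=> hb [t ht H]; exists t => //; apply: leq_trans hb. Qed.

Lemma updE f i v j : upd f i v j = if j == i then v else f j.
Proof. by []. Qed.

Lemma hid_eq d d' : (hid d == hid d') = (d == d').
Proof. by rewrite /hid eqSS -!muln2 eqn_pmul2r. Qed.

Lemma even_hid x d : (x.*2 == hid d) = false.
Proof. by apply/eqP => /(congr1 odd); rewrite /= !odd_double. Qed.

Lemma hid_even x d : (hid d == x.*2) = false.
Proof. by rewrite eq_sym even_hid. Qed.

Lemma even_eq x y : (x.*2 == y.*2) = (x == y).
Proof. by rewrite -!muln2 eqn_pmul2r. Qed.

Definition hid_updE := (updE, hid_eq, even_hid, hid_even, even_eq, eqxx).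

Definition same_below (d : nat) (r r' : nat -> nat) :=
  forall e, e < d -> r' (hid e) = r (hid e).

Ltac step H := case/code_at_cons: H => ? H;
  eapply runs_step; first (rewrite /ram_step; match goal with
    E : nth _ _ _ = _ |- _ => rewrite E; clear E end; reflexivity).

Ltac fin := rewrite /= ?addnS ?addn0 ?addnA; exact: runs_refl.

Lemma cexp_correct P e d o r m s n :
  code_at P o (cexp e d) -> (forall x, r x.*2 = rg s x) -> m = mm s -> m 0 = n ->
  exists r', [/\ runs P (size (cexp e 0)) (RamSt o r m)
                   (RamSt (o + size (cexp e d)) r' m),
    r' (hid d) = ev n s e, (forall x, r' x.*2 = rg s x) & same_below d r r'].
Proof.
move=> + + mE m0; elim: e d o r => [x|c||e1 IH1 e2 IH2|e1 IH1 e2 IH2|a e1 IH1] d o r H hr /=.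
- eexists; split; first (step H; step H; fin).
  + by rewrite !hid_updE hr addn0.
  + by move=> y; rewrite !hid_updE hr.
  + by move=> k kd; rewrite !hid_updE (ltn_eqF kd).
- eexists; split; first (step H; fin).
  + by rewrite !hid_updE.
  + by move=> y; rewrite !hid_updE hr.
  + by move=> k kd; rewrite !hid_updE (ltn_eqF kd).
- eexists; split; first (step H; step H; fin).
  + by rewrite !hid_updE.
  + by move=> y; rewrite !hid_updE hr.
  + by move=> k kd; rewrite !hid_updE (ltn_eqF kd).
- case/code_at_cat: H => H1 /code_at_cat [H2 H3].
  have [r1 [R1 v1 u1 b1]] := IH1 _ _ _ H1 hr.
  have [r2 [R2 v2 u2 b2]] := IH2 _ _ _ H2 u1.
  eexists; split.
  + rewrite !size_cat addnA !(size_cexp _ 1) addnA.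
    apply: runs_trans; first by apply: runs_trans R1 R2.
    step H3; fin.
  + by rewrite !hid_updE v2 b2 // v1.
  + by move=> y; rewrite !hid_updE u2.
  + by move=> k kd; rewrite !hid_updE (ltn_eqF kd) b2 ?b1 // ltnS ltnW.
- case/code_at_cat: H => H1 /code_at_cat [H2 H3].
  have [r1 [R1 v1 u1 b1]] := IH1 _ _ _ H1 hr.
  have [r2 [R2 v2 u2 b2]] := IH2 _ _ _ H2 u1.
  eexists; split.
  + rewrite !size_cat addnA !(size_cexp _ 1) addnA.
    apply: runs_trans; first by apply: runs_trans R1 R2.
    step H3; fin.
  + by rewrite !hid_updE v2 b2 // v1.
  + by move=> y; rewrite !hid_updE u2.
  + by move=> k kd; rewrite !hid_updE (ltn_eqF kd) b2 ?b1 // ltnS ltnW.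
- case/code_at_cat: H => H1 H2.
  have [r1 [R1 v1 u1 b1]] := IH1 _ _ _ H1 hr.
  eexists; split.
  + rewrite !size_cat.
    apply: runs_trans; first exact: R1.
    do 5! step H2; fin.
  + rewrite !hid_updE (ltn_eqF (ltnSn d)) v1 -mE; congr (m (_ + _)); lia.
  + by move=> y; rewrite !hid_updE u1.
  + by move=> k kd; rewrite !hid_updE (ltn_eqF kd) (@ltn_eqF k d.+1) ?b1 //; lia.
Qed.

Lemma iteri_ind (T : Type) (I : nat -> T -> Prop) N f x :
  I 0 x -> (forall i y, i < N -> I i y -> I i.+1 (f i y)) -> I N (iteri N f x).
Proof.
move=> I0 IS; elim: N IS => //= N IH IS; apply: (IS _ _ (ltnSn N)).
by apply: IH => i y hi; apply: IS; apply: ltnW.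
Qed.

Definition sim (s : store) (n : nat) (r m : nat -> nat) :=
  [/\ forall x, r x.*2 = rg s x, m = mm s & m 0 = n].

Lemma ccom_If e c1 c2 o d :
  let p0 := cexp e d in
  let p1 := ccom c1 (o + size p0 + 1) d in
  let o2 := o + size p0 + 1 + size p1 + 1 in
  let p2 := ccom c2 o2 d in
  ccom (If e c1 c2) o d =
  p0 ++ [:: IJz (hid d) o2] ++ p1 ++ [:: IJmp (o2 + size p2)] ++ p2.
Proof. by []. Qed.

Lemma ccom_For x b c1 o d :
  let p1 := ccom c1 (o + 9) d.+1 in
  ccom (For x b c1) o d =
  [:: IConst (hid d) 0;
      IConst (hid d.+1) 0; ILoad (hid d.+1) (hid d.+1);
      IConst (hid d.+2) b; IAdd (hid d.+1) (hid d.+1) (hid d.+2);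
      ISub (hid d.+1) (hid d.+1) (hid d);
      IJz (hid d.+1) (o + 9 + size p1 + 3);
      IConst (hid d.+1) 0; IAdd x.*2 (hid d) (hid d.+1)] ++ p1 ++
  [:: IConst (hid d.+1) 1; IAdd (hid d) (hid d) (hid d.+1); IJmp (o + 1)].
Proof. by []. Qed.

Ltac jstep := eapply runs_step;
  first (rewrite /ram_step; match goal with
    E : nth IHalt ?P ?o = _ |- context [nth IHalt ?P ?o] => rewrite E end; reflexivity).

(** The clause [same_below] is what carries the induction through loops: it keeps the counters of
    the enclosing loops alive across the body. *)
Lemma ccom_correct P c d o r m s n :
  code_at P o (ccom c o d) -> sim s n r m ->
  exists r' m', [/\ runs P (cost n c) (RamSt o r m)
                      (RamSt (o + size (ccom c o d)) r' m'),
    sim (eval n c s) n r' m' & same_below d r r'].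
Proof.
elim: c d o r m s =>
  [|x e|a e1 e2|c1 IH1 c2 IH2|e c1 IH1 c2 IH2|x b c1 IH1] d o r m s H S.
- by exists r, m; rewrite addn0; split=> //; exact: runs_refl.
- case: (S) => hr hm m0; case/code_at_cat: H => H1 H2.
  have [r1 [R1 v1 u1 b1]] := cexp_correct H1 hr hm m0.
  eexists _, m; split.
  + rewrite /= size_cat; apply: runs_trans R1 _.
    do 2! step H2; fin.
  + by split=> //= y; rewrite !hid_updE (ltn_eqF (ltnSn d)) v1 addn0 u1.
  + by move=> k kd; rewrite !hid_updE (@ltn_eqF k d.+1) ?b1 //; lia.
- case: (S) => hr hm m0; case/code_at_cat: H => H1 /code_at_cat [H2 H3].
  have [r1 [R1 v1 u1 b1]] := cexp_correct H1 hr hm m0.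
  have [r2 [R2 v2 u2 b2]] := cexp_correct H2 u1 hm m0.
  eexists _, _; split.
  + rewrite /= !size_cat addnA.
    apply: runs_trans; first by apply: runs_trans R1 R2.
    do 10! step H3; fin.
  + have dd : forall i j, i < j -> ((i == j) = false) * ((j == i) = false).
      by move=> i j ij; rewrite ltn_eqF // gtn_eqF.
    rewrite !hid_updE !(dd d d.+1) // !(dd d d.+2) // !(dd d.+1 d.+2) //.
    rewrite m0 v2 b2 // v1 hm.
    split.
    * by move=> y; rewrite !hid_updE u2.
    * by congr upd; lia.
    * by rewrite /upd ltn_eqF -?hm //; lia.
  + move=> k kd; rewrite !hid_updE (@ltn_eqF k d) ?(@ltn_eqF k d.+2) ?b2 ?b1 //; lia.
- case/code_at_cat: H => H1 H2.
  have [r1 [m1 [R1 S1 b1]]] := IH1 _ _ _ _ _ H1 S.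
  have [r2 [m2 [R2 S2 b2]]] := IH2 _ _ _ _ _ H2 S1.
  exists r2, m2; split=> //.
  + by rewrite /= size_cat addnA; apply: runs_trans R1 R2.
  + by move=> k kd; rewrite b2 ?b1.
- case: (S) => hr hm m0; move: H; rewrite ccom_If.
  set p0 := cexp e d; set p1 := ccom c1 _ d; set o2 := o + _ + 1 + _ + 1.
  set p2 := ccom c2 o2 d; case/code_at_cat=> H0 H.
  have [r0 [R0 v0 u0 b0]] := cexp_correct H0 hr hm m0.
  have S0 : sim s n r0 m by [].
  case/code_at_cons: H => J1; rewrite -addn1 => /code_at_cat [H1 /code_at_cons[J2 H2]].
  rewrite /=; case: ifP => E.
  + have [r1 [m1 [R1 S1 b1]]] := IH1 _ _ _ _ _ H1 S0.
    exists r1, m1; split=> //; last by move=> k kd; rewrite b1 ?b0.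
    apply: (@runs_leq _ (size (cexp e 0) + (cost n c1 + 1).+1)); first by lia.
    apply: runs_trans R0 _; apply: runs_step.
      by rewrite /ram_step J1 v0 (negbTE E) -addn1.
    apply: runs_trans R1 _; apply: runs_step; first by rewrite /ram_step J2.
    by apply: runs_pc; rewrite !size_cat /= size_cat /=; lia.
  + rewrite -[_.+1]addn1 -/o2 in H2.
    have [r1 [m1 [R1 S1 b1]]] := IH2 _ _ _ _ _ H2 S0.
    exists r1, m1; split=> //; last by move=> k kd; rewrite b1 ?b0.
    apply: (@runs_leq _ (size (cexp e 0) + (cost n c2 + 0).+1)); first by lia.
    apply: runs_trans R0 _; apply: runs_step.
      by rewrite /ram_step J1 v0 (negbFE E).
    apply: runs_trans R1 _.
    by apply: runs_pc; rewrite -/p2 !size_cat /= size_cat /= /o2; lia.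
- case: (S) => hr hm m0.
  have dd : forall i j, i < j -> ((i == j) = false) * ((j == i) = false).
    by move=> i j ij; rewrite ltn_eqF // gtn_eqF.
  have d1 := dd _ _ (ltnSn d); have d2 : d < d.+2 by lia.
  have {}d2 := dd _ _ d2; have d3 := dd _ _ (ltnSn d.+1).
  move: H; rewrite ccom_For.
  set p1 := ccom c1 (o + 9) d.+1; set oe := o + 9 + size p1 + 3.
  case/code_at_cons => I0; do 8!case/code_at_cons => ?.
  have -> : o.+4.+4.+1 = o + 9 by lia.
  case/code_at_cat => H1; do 3!case/code_at_cons => ?; move=> _.
  pose f i s' := eval n c1 (setr s' x i).
  (* Loop invariant: after [j] passes the machine is back at the test, with [j] in the counter. *)
  have L : forall j, j <= n + b -> exists r' m',
     [/\ runs P (j * (cost n c1 + 11)) (RamSt o.+1 (upd r (hid d) 0) m) (RamSt o.+1 r' m'),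
       sim (iteri j f s) n r' m', r' (hid d) = j & same_below d r r'].
    elim=> [|j IHj] hj.
      exists (upd r (hid d) 0), m; split; rewrite ?hid_updE //; first exact: runs_refl.
        by split=> // y; rewrite !hid_updE hr.
      by move=> k kd; rewrite !hid_updE (dd _ _ kd).
    have [r2 [m2 [R2 [hr2 hm2 m20] e2 b2]]] := IHj (ltnW hj).
    have [r3 [R3 S3 r3d b3]] : exists r3, [/\ runs P 8 (RamSt o.+1 r2 m2)
        (RamSt (o + 9) r3 m2), sim (setr (iteri j f s) x j) n r3 m2,
        r3 (hid d) = j & same_below d r2 r3].
      eexists; split.
      - do 5!jstep.
        apply: runs_step.
          by match goal with E : nth _ _ _ = IJz _ _ |- _ => rewrite /ram_step E end.
        rewrite !hid_updE ?(d1, d2, d3) ?hid_updE e2 m20.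
        have /negbTE -> : n + b - j != 0 by rewrite subn_eq0 -ltnNge.
        do 2!jstep.
        by apply: runs_pc; lia.
      - by split=> // y; rewrite ?hid_updE ?(d1, d2, d3) e2 addn0 hr2.
      - by rewrite ?hid_updE ?(d1, d2, d3).
      - by move=> k kd; rewrite !hid_updE !(dd k d, dd k d.+1, dd k d.+2) //; lia.
    have [r4 [m4 [R4 [hr4 hm4 m40] b4]]] := IH1 _ _ _ _ _ H1 S3.
    eexists _, m4; split.
    * rewrite mulSn addnC; apply: runs_trans R2 _.
      apply: (@runs_leq _ (8 + (cost n c1 + 3))); first by lia.
      apply: runs_trans R3 _; apply: runs_trans R4 _.
      do 3!jstep.
      by apply: runs_pc; lia.
    * by split=> // y; rewrite !hid_updE hr4.
    * by rewrite ?hid_updE ?(d1, d2, d3) b4 // r3d addn1.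
    * by move=> k kd; rewrite !hid_updE !(dd k d, dd k d.+1) ?b4 ?b3 ?b2 //; lia.
  have [r1 [m1 [R1 [hr1 hm1 m10] e1 b1]]] := L _ (leqnn _).
  eexists _, _; split.
  + rewrite [cost _ _]/= addnS; apply: runs_step; first by rewrite /ram_step I0.
    apply: runs_trans R1 _.
    do 5!jstep.
    apply: runs_step.
      by match goal with E : nth _ _ _ = IJz _ _ |- _ => rewrite /ram_step E end.
    rewrite !hid_updE ?(d1, d2, d3) ?hid_updE e1 m10 subnn /=.
    by apply: runs_pc; rewrite /= size_cat /= /oe; lia.
  + by split=> // y; rewrite !hid_updE hr1.
  + by move=> k kd; rewrite !hid_updE !(dd k d, dd k d.+1, dd k d.+2) ?b1 //; lia.
Qed.

(** * Polynomial bound on the cost *)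

Fixpoint depth (c : com) : nat :=
  match c with
  | Seq c1 c2 | If _ c1 c2 => maxn (depth c1) (depth c2)
  | For _ _ c1 => (depth c1).+1
  | _ => 0
  end.

(** The base is [n.+1] rather than [n] so that the power is positive and absorbs additive
    constants. *)
Lemma cost_bound c : exists K, forall n, cost n c <= K * n.+1 ^ depth c.
Proof.
elim: c => [|x e|a e1 e2|c1 [K1 H1] c2 [K2 H2]|e c1 [K1 H1] c2 [K2 H2]|x b c1 [K1 H1]].
- by exists 0.
- by exists (size (cexp e 0) + 2) => n; rewrite muln1.
- by exists (size (cexp e1 0) + size (cexp e2 0) + 10) => n; rewrite muln1.
- exists (K1 + K2) => n; rewrite mulnDl leq_add //=.
    by apply: leq_trans (H1 n) _; rewrite leq_mul2l leq_pexp2l ?leq_maxl ?orbT.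
  by apply: leq_trans (H2 n) _; rewrite leq_mul2l leq_pexp2l ?leq_maxr ?orbT.
- exists (size (cexp e 0) + 2 + (K1 + K2)) => n; rewrite mulnDl /= -addnA leq_add //.
    by rewrite leq_pmulr // expn_gt0.
  rewrite mulnDl leq_add //.
    by apply: leq_trans (H1 n) _; rewrite leq_mul2l leq_pexp2l ?leq_maxl ?orbT.
  by apply: leq_trans (H2 n) _; rewrite leq_mul2l leq_pexp2l ?leq_maxr ?orbT.
- exists (b.+1 * (K1 + 11) + 7) => n.
  rewrite [cost _ _]/= [depth _]/= [leqRHS]mulnDl leq_add ?leq_pmulr ?expn_gt0 //.
  have hb : n + b <= n.+1 * b.+1 by nia.
  have p0 : 0 < n.+1 ^ depth c1 by rewrite expn_gt0.
  have hc : cost n c1 + 11 <= (K1 + 11) * n.+1 ^ depth c1.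
    by rewrite mulnDl leq_add // leq_pmulr.
  apply: leq_trans (leq_mul hb hc) _.
  by rewrite expnS leq_eqVlt; apply/orP; left; apply/eqP; ring.
Qed.

Lemma ram_decides_com c inp n K (answer : Prop) :
  inp 0 = n -> cost n c <= K ->
  (rg (eval n c (Store (fun=> 0) inp)) 0 != 0 <-> answer) ->
  ram_decides_within (ccom c 0 0) inp K answer.
Proof.
move=> h0 hK hans; pose s0 := Store (fun=> 0) inp.
have S0 : sim s0 n (fun=> 0) inp by [].
have C0 : code_at (ccom c 0 0) 0 (ccom c 0 0) by [].
have [r [m [[t ht R] [hr _ _] _]]] := ccom_correct C0 S0.
exists (RamSt (size (ccom c 0 0)) r m); split; last by rewrite /= -hans -hr.
rewrite /ram_init -(subnKC (leq_trans ht hK)) R add0n.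
(* The program counter is just past the code, where the default instruction [IHalt] stops the
   machine whatever fuel remains. *)
by case: (K - t) => [|k] /=; rewrite nth_default.
Qed.

(** * Frame properties *)

Fixpoint assigned (c : com) : seq nat :=
  match c with
  | Set_ x _ => [:: x]
  | Seq c1 c2 | If _ c1 c2 => assigned c1 ++ assigned c2
  | For x _ c1 => x :: assigned c1
  | _ => [::]
  end.

Fixpoint columns (c : com) : seq nat :=
  match c with
  | Put a _ _ => [:: a]
  | Seq c1 c2 | If _ c1 c2 => columns c1 ++ columns c2
  | For _ _ c1 => columns c1
  | _ => [::]
  end.

Lemma rg_frame n c s x : x \notin assigned c -> rg (eval n c s) x = rg s x.
Proof.
elim: c s => [|y e|a e1 e2|c1 IH1 c2 IH2|e c1 IH1 c2 IH2|y b c1 IH1] s //=.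
- by rewrite inE updE => /negbTE ->.
- by rewrite mem_cat negb_or => /andP[h1 h2]; rewrite IH2 ?IH1.
- by rewrite mem_cat negb_or => /andP[h1 h2]; case: ifP; rewrite ?IH2 ?IH1.
- rewrite inE negb_or => /andP[/negbTE h1 h2].
  by elim: (n + b) => //= k IHk; rewrite IH1 //= updE h1.
Qed.

Lemma mm_input n c s i : i < 4 * (n + 1) -> mm (eval n c s) i = mm s i.
Proof.
move=> hi; elim: c s => [|y e|a e1 e2|c1 IH1 c2 IH2|e c1 IH1 c2 IH2|y b c1 IH1] s //=.
- by rewrite updE; case: eqP => // E; lia.
- by rewrite IH2 ?IH1.
- by case: ifP; rewrite ?IH2 ?IH1.
- by elim: (n + b) => //= k IHk; rewrite IH1.
Qed.

(** Addresses determine their column modulo four once all column numbers are below four. *)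
Lemma mm_column n c s a i : a < 4 -> all (fun b => b < 4) (columns c) ->
  a \notin columns c -> mm (eval n c s) (4 * i + a) = mm s (4 * i + a).
Proof.
move=> a4; elim: c s => [|y e|b e1 e2|c1 IH1 c2 IH2|e c1 IH1 c2 IH2|y b c1 IH1] s //=.
- rewrite inE updE andbT => b4 /eqP ab; case: eqP => // E; lia.
- rewrite all_cat mem_cat negb_or => /andP[g1 g2] /andP[h1 h2]; by rewrite IH2 ?IH1.
- rewrite all_cat mem_cat negb_or => /andP[g1 g2] /andP[h1 h2].
  by case: ifP; rewrite ?IH2 ?IH1.
- by move=> g h; elim: (n + b) => //= k IHk; rewrite IH1.
Qed.

(** Unrolled at compile time: the index is a literal in the body, and the loop depth does not
    grow. *)
Definition Each (m : nat) (c : nat -> com) : com :=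
  iteri m (fun k acc => Seq acc (c k)) Skip.

Lemma eval_Each n m c s : eval n (Each m c) s = iteri m (fun k => eval n (c k)) s.
Proof. by elim: m => //= m ->. Qed.

(** * Breadth-first orders have bandwidth two *)

Section Instance.
Variable inp : nat -> nat.
Local Notation n := (inp 0).

(* Voters are numbered from [1]; the entry [0] pads bundles of fewer than three
   members. *)
Definition nbs (u : nat) : seq nat := [seq inp (4 * u + a.+1) | a <- iota 0 3].

Arguments nbs : simpl never.

(** The degree bound two is implicit: [nbs u] has length three and contains [u]. *)
Record closed_nbhds : Prop := ClosedNbhds {
  nbs_le : forall u v, 0 < u <= n -> v \in nbs u -> v <= n;
  nbs_refl : forall u, 0 < u <= n -> u \in nbs u;
  nbs_sym : forall u v, 0 < u <= n -> 0 < v <= n -> v \in nbs u -> u \in nbs v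
}.
Hypothesis N : closed_nbhds.

Definition visit (l : seq nat) (u : nat) : seq nat :=
  if (u == 0) || (u \in l) then l else rcons l u.

(* The queue [l] after its first [h] members have been processed. *)
Record bfs_inv (h : nat) (l : seq nat) : Prop := BfsInv {
  bfs_uniq : uniq l;
  bfs_sub : {in l, forall u, 0 < u <= n};
  bfs_size : h <= size l <= h + 2;
  bfs_done : forall q v, q < h -> v \in nbs (nth 0 l q) -> v != 0 ->
    v \in l /\ index v l <= q + 2;
  bfs_parent : forall q, h <= q < size l ->
    exists2 q', q' < h & nth 0 l q \in nbs (nth 0 l q')
}.

Lemma foldl_visit l xs : uniq l -> exists ps, [/\ foldl visit l xs = l ++ ps,
  uniq (l ++ ps), {subset ps <= xs}, 0 \notin ps &
  forall v, v \in xs -> v != 0 -> v \in l ++ ps].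
Proof.
elim: xs l => [|x xs IH] l ul /=.
  by exists [::]; rewrite cats0; split.
rewrite {2}/visit; case: ifP => hx.
  have [ps [-> u1 s1 z1 a1]] := IH _ ul; exists ps; split=> //.
    by move=> v /s1; rewrite inE => ->; rewrite orbT.
  move=> v; rewrite inE => /orP[/eqP ->|]; last exact: a1.
  by case/orP: hx => [->|hx] //; rewrite mem_cat hx.
have {}hx := negbT hx; rewrite negb_or in hx; case/andP: hx => x0 xl.
have ul' : uniq (rcons l x) by rewrite rcons_uniq xl.
have [ps [-> u1 s1 z1 a1]] := IH _ ul'; exists (x :: ps).
rewrite -cat_rcons; split=> //.
- by move=> v; rewrite !inE => /orP[->//|/s1 ->]; rewrite orbT.
- by rewrite inE negb_or eq_sym x0.
- move=> v; rewrite inE => /orP[/eqP -> _|]; last exact: a1.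
  by rewrite mem_cat mem_rcons mem_head.
Qed.

Lemma bfs_inv0 : bfs_inv 0 [::].
Proof. by split. Qed.

(** The bound on the queue survives because a vertex found from an earlier one has at most one new
    neighbour, while a root has at most two but is appended only when the queue is exhausted. Either
    way the length is at most [h + 3]. *)
Lemma bfs_step h l l' : bfs_inv h l -> h < n ->
  (size l != h /\ l' = l \/
   size l = h /\ exists2 u, 0 < u <= n /\ u \notin l & l' = rcons l u) ->
  bfs_inv h.+1 (foldl visit l' (nbs (nth 0 l' h))).
Proof.
move=> I hn hl'.
have ul' : uniq l'.
  case: hl' => [[_ ->]|[_ [u [_ nu] ->]]]; first exact: bfs_uniq I.
  by rewrite rcons_uniq nu (bfs_uniq I).
have sl' : {in l', forall u, 0 < u <= n}.
  case: hl' => [[_ ->]|[_ [u [hu _] ->]]] v; first by move=> vl; apply: (bfs_sub I).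
  by rewrite mem_rcons inE => /orP[/eqP ->|vl] //; apply: (bfs_sub I).
have hs : h < size l'.
  case: hl' => [[h1 ->]|[h1 [u [hu _] ->]]]; last by rewrite size_rcons h1.
  by have := bfs_size I; lia.
have prefix_nth q : q < h -> nth 0 l' q = nth 0 l q.
  have := bfs_size I.
  case: hl' => [[h1 ->]|[h1 [u [hu _] ->]]] // hh qh.
  by rewrite nth_rcons h1 qh.
have prefix_idx v : v \in l -> v \in l' /\ index v l' = index v l.
  case: hl' => [[h1 ->]|[h1 [u [hu _] ->]]] // vl.
  by rewrite mem_rcons inE vl orbT -cats1 index_cat vl.
set x := nth 0 l' h; have xl' : x \in l' by apply: mem_nth.
have hx := sl' _ xl'.
have [ps [-> u1 s1 z1 a1]] := foldl_visit (nbs x) ul'.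
have disj v : v \in l' -> v \notin ps.
  move=> vl'; apply/negP => vps; move: u1; rewrite cat_uniq => /and3P[_ /hasP[]].
  by exists v.
have ups : uniq ps by move: u1; rewrite cat_uniq => /and3P[].
have sz : size (l' ++ ps) <= h + 3.
  have {}xps := disj _ xl'; rewrite size_cat.
  case: hl' => [[h1 el']|[h1 [u [hu _] el']]].
    have hh := bfs_size I; have [|q' qh] := @bfs_parent _ _ I h; first by lia.
    rewrite -(prefix_nth q') // -el' -/x => xq'.
    have yl' : nth 0 l' q' \in l' by apply: mem_nth; apply: ltn_trans hs.
    set y := nth 0 l' q' in xq' yl'.
    have yx : y != x by rewrite nth_uniq // ?(ltn_trans qh) // neq_ltn qh.
    (* [x], its parent [y] and the new vertices are distinct entries of a list of length three, so
       at most one vertex is new. *)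
    have : size [:: x, y & ps] <= size (nbs x).
      apply: uniq_leq_size; first by rewrite /= inE negb_or eq_sym yx xps (disj _ yl').
      move=> v; rewrite 2!in_cons => /or3P[/eqP ->|/eqP ->|/s1 //]; first exact: (nbs_refl N).
      by apply: (nbs_sym N) => //; apply: sl'.
    by rewrite el' /= ; lia.
  have : size [:: x & ps] <= size (nbs x).
    apply: uniq_leq_size; first by rewrite /= xps.
    by move=> v; rewrite in_cons => /orP[/eqP ->|/s1 //]; exact: (nbs_refl N).
  by rewrite el' size_rcons /=; lia.
split=> //.
- move=> v; rewrite mem_cat => /orP[/sl' //|vps].
  rewrite (nbs_le N hx (s1 _ vps)) andbT lt0n.
  by apply: contraNneq z1 => <-.
- by rewrite size_cat in sz *; lia.
- move=> q v; rewrite ltnS leq_eqVlt => /orP[/eqP ->|qh].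
    rewrite nth_cat hs -/x => vx v0; have va := a1 _ vx v0; split=> //.
    (* Every neighbour of the vertex at position [h] is now in a queue of length at most [h + 3]. *)
    by move: va; rewrite -index_mem => hi; have := leq_trans hi sz; rewrite addn3 ltnS addn2.
  rewrite nth_cat (ltn_trans qh hs) prefix_nth // => vx v0.
  have [vl iv] := bfs_done I qh vx v0; have [vl' iv'] := prefix_idx _ vl.
  by rewrite mem_cat vl' index_cat vl' iv'.
- move=> q /andP[hq qs]; case: (ltnP q (size l')) => ql; last first.
    exists h => //; rewrite nth_cat ltnNge ql /= nth_cat hs -/x; apply: s1.
    by apply: mem_nth; rewrite ltn_subLR // -size_cat.
  case: hl' => [[h1 el']|[h1 [u [hu _] el']]]; last first.
    by move: ql; rewrite el' size_rcons h1; lia.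
  have [|q' qh hp] := @bfs_parent _ _ I q; first by rewrite -el'; lia.
  exists q'; first exact: ltnW.
  by rewrite !nth_cat ql (ltn_trans qh hs) (prefix_nth q') // el'.
Qed.

Record bandwidth2 (l : seq nat) : Prop := Bandwidth2 {
  bw_perm : perm_eq l (iota 1 n);
  bw_nbs : forall u v, 0 < u <= n -> v \in nbs u -> v != 0 ->
    index v l <= index u l + 2 /\ index u l <= index v l + 2
}.

(** A duplicate-free list of at least [n] vertices exhausts them. The invariant bounds how far a
    neighbour can come after a vertex; symmetry of adjacency gives the other direction. *)
Lemma bfs_bandwidth2 l : bfs_inv n l -> bandwidth2 l.
Proof.
move=> I; have sub : {subset l <= iota 1 n}.
  by move=> u /(bfs_sub I); rewrite mem_iota; lia.
have hs := uniq_leq_size (bfs_uniq I) sub; rewrite size_iota in hs.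
have P : perm_eq l (iota 1 n).
  apply: uniq_perm; rewrite ?iota_uniq ?(bfs_uniq I) //.
  have hle : size (iota 1 n) <= size l.
    by rewrite size_iota; case/andP: (bfs_size I).
  by case: (uniq_min_size (bfs_uniq I) sub hle).
have mem u : 0 < u <= n -> u \in l by rewrite (perm_mem P) mem_iota; lia.
have half u v : 0 < u <= n -> v \in nbs u -> v != 0 -> index v l <= index u l + 2.
  move=> hu vu v0; have iu : index u l < n.
    by rewrite -[X in _ < X](size_iota 1) -(perm_size P) index_mem mem.
  by apply: (bfs_done I iu _ v0).2; rewrite nth_index ?mem.
split=> // u v hu vu v0; split; first exact: half.
have hv : 0 < v <= n by rewrite lt0n v0 (nbs_le N hu).
by apply: half => //; [exact: (nbs_sym N) | lia].
Qed.
End Instance.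

(** * Dynamic programming over a sliding window *)

(* [best g M r s j] is the largest gain of the last [r] of [M] steps when [s]
   codes the preceding four choices, latest in the lowest bit, and at most [j]
   more voters may be chosen.  Steps are numbered from [1], so the next one is
   [M - r + 1]. *)
Fixpoint best (g : nat -> nat -> nat) (M r s j : nat) : nat :=
  if r is r'.+1 then
    maxn (g (M - r') (2 * s) + best g M r' ((2 * s) %% 16) j)
         (if j is j'.+1
          then g (M - r') (2 * s + 1) + best g M r' ((2 * s + 1) %% 16) j'
          else 0)
  else 0.

Fixpoint total (g : nat -> nat -> nat) (i s : nat) (bs : seq bool) : nat :=
  if bs is b :: bs' then g i (2 * s + b) + total g i.+1 ((2 * s + b) %% 16) bs'
  else 0.

(** Together with [best_attained], this makes [best] the maximum of [total] over the choice
    sequences within the budget. *)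
Lemma total_le_best g M bs s j : size bs <= M -> count id bs <= j ->
  total g (M - size bs).+1 s bs <= best g M (size bs) s j.
Proof.
elim: bs s j => //= b bs IH s j hs hc; rewrite leq_max subnSK //.
case: b hc => /= hc; last first.
  by rewrite addn0 leq_add2l IH // ltnW.
by case: j hc => //= j hc; rewrite leq_add2l IH ?orbT // ltnW.
Qed.

Lemma best_attained g M r s j : r <= M -> exists bs,
  [/\ size bs = r, count id bs <= j & total g (M - r).+1 s bs = best g M r s j].
Proof.
elim: r s j => [|r IH] s j hr; first by exists [::].
rewrite /=; case: (leqP (if j is j'.+1 then _ else 0) _) => h.
  have [bs [h1 h2 h3]] := IH ((2 * s) %% 16) j (ltnW hr).
  exists (false :: bs); split=> //=; first by rewrite h1.
  by rewrite addn0 subnSK // h3.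
(* With an exhausted budget the second argument of the maximum is [0], which cannot be strictly
   larger. *)
case: j h => // j h.
have [bs [h1 h2 h3]] := IH ((2 * s + 1) %% 16) j (ltnW hr).
exists (true :: bs); split=> //=; first by rewrite h1.
by rewrite subnSK // h3.
Qed.

(** * Windows of the last five choices *)

Definition state (bs : seq bool) : nat :=
  foldl (fun s (b : bool) => (2 * s + b) %% 16) 0 bs.

Definition window (bs : seq bool) (i : nat) : nat :=
  2 * state (take i bs) + nth false bs i.

(** Generalised over an already consumed prefix [p], which [total] knows only through its length and
    its state. *)
Lemma total_sum g bs :
  total g 1 0 bs = \sum_(i < size bs) g i.+1 (window bs i).
Proof.
have gen p q : total g (size p).+1 (state p) q =
    \sum_(i < size q) g (size p + i).+1 (window (p ++ q) (size p + i)).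
  elim: q p => [|b q IH] p; first by rewrite big_ord0.
  rewrite /= big_ord_recl addn0 /window take_size_cat // nth_cat ltnn subnn /=.
  congr (_ + _); have := IH (rcons p b).
  rewrite size_rcons /state foldl_rcons => ->.
  by apply: eq_bigr => i _; rewrite cat_rcons addSnnS.
exact: (gen [::] bs).
Qed.

Definition bit (k w : nat) : bool := odd (w %/ 2 ^ k).

Lemma bit0 s (b : bool) : bit 0 (2 * s + b) = b.
Proof. by rewrite /bit divn1 oddD oddM; case: b. Qed.

Lemma bitS k s (b : bool) : bit k.+1 (2 * s + b) = bit k s.
Proof.
rewrite /bit expnS divnMA mulnC divnMDl // (@divn_small b 2) ?addn0 //.
by case: b.
Qed.

Lemma bit_mod16 k w : k < 4 -> bit k (w %% 16) = bit k w.
Proof.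
move=> hk; rewrite /bit {2}(divn_eq w 16).
have -> : 16 = 2 ^ (4 - k) * 2 ^ k by rewrite -expnD subnK // ltnW.
rewrite mulnA divnMDl ?expn_gt0 // oddD oddM oddX.
by rewrite (_ : (4 - k == 0) = false) ?andbF //; lia.
Qed.

Lemma bit_state bs k : k < 4 ->
  bit k (state bs) = (k < size bs) && nth false bs (size bs - k.+1).
Proof.
elim/last_ind: bs k => [|bs b IH] k hk; first by rewrite /bit div0n.
rewrite /state foldl_rcons -/(state bs) bit_mod16 // size_rcons ltnS.
case: k hk => [|k] hk.
  by rewrite bit0 /= subn1 /= nth_rcons ltnn eqxx.
rewrite bitS IH ?(ltnW hk) // subSS nth_rcons; case: ltnP => //= hks.
by rewrite (_ : size bs - k.+1 < size bs) //; lia.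
Qed.

(** The guard [k <= i] reflects the initial state [0]: positions before the first count as not
    chosen. *)
Lemma bit_window bs i k : k < 5 -> i < size bs ->
  bit k (window bs i) = (k <= i) && nth false bs (i - k).
Proof.
case: k => [|k] hk hi; first by rewrite /window bit0 subn0.
rewrite /window bitS bit_state // size_take hi; case: ltnP => //= hki.
by rewrite nth_take //; lia.
Qed.

Section Gain.
Variable inp : nat -> nat.
Local Notation n := (inp 0).
Hypothesis N : closed_nbhds inp.

(* At step [i] the window ends at position [i - 1], and the voter [c] whose fate
   gets decided is at position [i - 3].  [P v] is one plus the position of [v],
   so bit [k] of the window is the choice made for [v] when [P v + k = i]. *)
Definition hit (P : nat -> nat) (c i w : nat) : bool :=
  has (fun k => bit k w && has (fun v => P v + k == i) (nbs inp c)) (iota 0 5).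

(** A decision waits until the two positions after the voter are chosen, so the first two steps gain
    nothing and [n + 2] steps are needed in all. *)
Definition gain (l : seq nat) (P : nat -> nat) (i w : nat) : nat :=
  if i <= 2 then 0 else
  let c := nth 0 l (i - 3) in if hit P c i w then 2 * inp (4 * c) else 1.

Definition value (chosen : nat -> bool) : nat :=
  \sum_(u <- iota 1 n)
    if has (fun v => (v != 0) && chosen v) (nbs inp u) then 2 * inp (4 * u) else 1.

(** By bandwidth two, the closed neighbourhood of the voter at position [m] lies in positions
    [m - 2], ..., [m + 2], which is the window of step [m + 3]. *)
Lemma total_gain l P bs : bandwidth2 inp l -> P 0 = n + 3 ->
  (forall u, 0 < u <= n -> P u = (index u l).+1) -> size bs = n + 2 ->
  total (gain l P) 1 0 bs = value (fun v => nth false bs (index v l)).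
Proof.
move=> B P0 Pu hb; have sl : size l = n by rewrite (perm_size (bw_perm B)) size_iota.
rewrite total_sum hb addn2 !big_ord_recl /gain /= !add0n.
rewrite /value -(perm_big _ (bw_perm B)) (big_nth 0) sl big_mkord.
apply: eq_bigr => m _; rewrite /bump !add1n !subSS subn0.
set u := nth 0 l m; have ul : u \in l by rewrite mem_nth ?sl.
have hu : 0 < u <= n by move: ul; rewrite (perm_mem (bw_perm B)) mem_iota; lia.
have iu : index u l = m.
  by rewrite index_uniq ?sl // (perm_uniq (bw_perm B)) iota_uniq.
congr (if _ then _ else _); apply/hasP/hasP => [[k]|[v vu /andP[v0 hv]]].
  rewrite mem_iota add0n => /andP[_ k5] /andP[hbit /hasP[v vu /eqP e]].
  exists v => //; case: eqP => [v0|/eqP v0] /=.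
    (* The padding entry never matches: steps go up to [n + 2] only. *)
    by have := ltn_ord m; move: e; rewrite v0 P0; lia.
  have hv : 0 < v <= n by rewrite lt0n v0 (nbs_le N hu).
  move: hbit; rewrite bit_window ?hb //; last by have := ltn_ord m; lia.
  rewrite Pu // in e; case/andP => _; rewrite (_ : _ - _ = index v l) //; lia.
have hv' : 0 < v <= n by rewrite lt0n v0 (nbs_le N hu).
have [] := bw_nbs B hu vu v0; rewrite iu => h1 h2.
(* Solves [P v + k = m + 3] for [k], with [P v = (index v l).+1]. *)
exists (m.+2 - index v l); first by rewrite mem_iota; lia.
rewrite bit_window ?hb; [|lia|by have := ltn_ord m; lia].
apply/andP; split.
  by rewrite leq_subr /= (_ : _ - _ = index v l) //; lia.
by apply/hasP; exists v => //; rewrite Pu //; apply/eqP; lia.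
Qed.

Lemma eq_value c1 c2 : (forall v, 0 < v <= n -> c1 v = c2 v) -> value c1 = value c2.
Proof.
move=> h; apply: eq_big_seq => u; rewrite mem_iota => hu.
congr (if _ then _ else _); apply: eq_in_has => v vu.
case: eqP => //= /eqP v0; rewrite h // lt0n v0 (nbs_le N _ vu) //; lia.
Qed.

(** Capping the budget at [n] loses nothing, as there are only [n] voters, and keeps the table at
    [n + 1] budgets. *)
Lemma best_value l P k : bandwidth2 inp l -> P 0 = n + 3 ->
  (forall u, 0 < u <= n -> P u = (index u l).+1) ->
  forall t, t <= best (gain l P) (n + 2) (n + 2) 0 (minn k n) <->
  exists chosen, count chosen (iota 1 n) <= k /\ t <= value chosen.
Proof.
move=> B P0 Pu t; have sl : size l = n by rewrite (perm_size (bw_perm B)) size_iota.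
have ul : uniq l by rewrite (perm_uniq (bw_perm B)) iota_uniq.
split=> [h|[ch [hk ht]]].
  have [bs [h1 h2 h3]] :=
    @best_attained (gain l P) (n + 2) (n + 2) 0 (minn k n) (leqnn _).
  exists (fun v => nth false bs (index v l)); split; last first.
    by rewrite -(total_gain B P0 Pu h1) //; move: h3; rewrite subnn => ->.
  rewrite -(seq.permP (bw_perm B)).
  (* The last two choices belong to no voter; dropping them can only lower the count. *)
  have -> : count (fun v => nth false bs (index v l)) l = count id (take n bs).
    rewrite -[l in LHS](mkseq_nth 0) count_map sl.
    have -> : take n bs = mkseq (nth false bs) n.
      have st : size (take n bs) = n by rewrite size_takel // h1 leq_addr.
      apply: (@eq_from_nth _ false); first by rewrite size_mkseq.
      by move=> i; rewrite st => hi; rewrite nth_mkseq ?nth_take.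
    rewrite count_map; apply: eq_in_count => i; rewrite mem_iota => hi /=.
    by rewrite -sl mkseq_nth index_uniq // sl; lia.
  apply: leq_trans (leq_trans h2 (geq_minl _ _)).
  by rewrite -[bs in leqRHS](cat_take_drop n) count_cat leq_addr.
pose bs := [seq ch v | v <- l] ++ [:: false; false].
have sb : size bs = n + 2 by rewrite size_cat size_map sl.
have cb : count id bs <= minn k n.
  rewrite count_cat count_map /= addn0 (eq_count (a2 := ch)) // leq_min.
  rewrite (seq.permP (bw_perm B)) addn0 hk /=.
  by rewrite -[X in _ <= X](size_iota 1); exact: count_size.
have := total_le_best (gain l P) 0 (eq_leq sb) cb.
rewrite sb subnn (total_gain B P0 Pu sb) => h; apply: leq_trans h.
rewrite (@eq_value _ ch) // => v hv.
have vl : v \in l by rewrite (perm_mem (bw_perm B)) mem_iota; lia.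
by rewrite nth_cat size_map index_mem vl (nth_map 0) ?index_mem // nth_index.
Qed.
End Gain.

(** * The program *)

Local Arguments upd : simpl never.

Local Notation rT := 1.
Local Notation rU := 2.
Local Notation rH := 3.
Local Notation rV := 4.
Local Notation rR := 5.
Local Notation rI := 6.
Local Notation rC := 7.
Local Notation rCov := 8.
Local Notation rUnc := 9.
Local Notation rJ := 10.
Local Notation rJJ := 11.
Local Notation rX := 12.
Local Notation rY := 13.
Local Notation rFlag k := (20 + k).

(* Working rows: column 0 is the breadth-first queue; column 1 holds, for each
   voter, one plus its position in the queue, or [0] if it has not been found;
   columns 2 and 3 hold the current and the next table of [best], the entry for
   [s] and [j] being in row [16 j + s]. *)
Definition wget (a : nat) (e : exp) : exp := Get a (Add (Add Sz (Cst 1)) e).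

(** The sum acts as a disjunction: nothing is done if the voter has been found or the guard [g] is
    nonzero. *)
Definition visit_com (g : exp) : com :=
  If (Add (wget 1 (Var rU)) g) Skip
    (Seq (Put 0 (Var rT) (Var rU))
    (Seq (Set_ rT (Add (Var rT) (Cst 1)))
         (Put 1 (Var rU) (Var rT)))).

(** The guard [T - H], truncated, vanishes exactly when the queue is exhausted, so the scan over all
    voters appends at most one root. *)
Definition root_com : com :=
  For rV 0 (Seq (Set_ rU (Add (Var rV) (Cst 1)))
                (visit_com (Sub (Var rT) (Var rH)))).

Definition slots_com : com :=
  Each 3 (fun a => Seq (Set_ rU (Get a.+1 (wget 0 (Var rH)))) (visit_com (Cst 0))).

(* The value [n + 3] at the padding entry [0] makes it look found, and places it
   beyond every window. *)
Definition bfs_com : com :=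
  Seq (Put 1 (Cst 0) (Add Sz (Cst 3))) (For rH 0 (Seq root_com slots_com)).

(** [rR] counts the final steps already tabulated, so the current step is [n + 2 - rR]. [rCov] and
    [rUnc] hold the gains for a covered and an uncovered voter, both [0] in the first two steps. *)
Definition center_com : com :=
  Seq (Set_ rI (Sub (Add Sz (Cst 2)) (Var rR)))
      (If (Sub (Var rI) (Cst 2))
          (Seq (Set_ rC (wget 0 (Sub (Var rI) (Cst 3))))
          (Seq (Set_ rCov (Add (Get 0 (Var rC)) (Get 0 (Var rC))))
               (Set_ rUnc (Cst 1))))
          (Seq (Set_ rC (Cst 0)) (Seq (Set_ rCov (Cst 0)) (Set_ rUnc (Cst 0))))).

Definition differ (e1 e2 : exp) : exp := Add (Sub e1 e2) (Sub e2 e1).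

(** The part of [hit] that depends on the step but not on the window, computed once for all states
    and budgets. *)
Definition flag_com (k : nat) : com :=
  Seq (Set_ (rFlag k) (Cst 0))
      (Each 3 (fun a =>
         If (differ (Add (wget 1 (Get a.+1 (Var rC))) (Cst k)) (Var rI))
            Skip (Set_ (rFlag k) (Cst 1)))).

Definition flags_com : com := Seq center_com (Each 5 flag_com).

(** The window is a literal, so its bits select at compile time which flags enter the sum. *)
Definition flag_sum (w : nat) (ks : seq nat) : exp :=
  foldr (fun k e => if bit k w then Add (Var (rFlag k)) e else e) (Cst 0) ks.

Definition gain_com (x w : nat) : com :=
  If (flag_sum w (iota 0 5)) (Set_ x (Var rCov)) (Set_ x (Var rUnc)).

(** [rJJ] holds [16 j], the base row of budget [j]; hence [rJJ - 16] is that of [j - 1]. *)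
Definition cell_com (s : nat) : com :=
  Seq (gain_com rX (2 * s))
  (Seq (Set_ rX (Add (Var rX) (wget 2 (Add (Var rJJ) (Cst ((2 * s) %% 16))))))
  (Seq (If (Var rJ)
         (Seq (gain_com rY (2 * s + 1))
         (Seq (Set_ rY (Add (Var rY)
                 (wget 2 (Add (Sub (Var rJJ) (Cst 16)) (Cst ((2 * s + 1) %% 16))))))
              (If (Sub (Var rY) (Var rX)) (Set_ rX (Var rY)) Skip)))
         Skip)
       (Put 3 (Add (Var rJJ) (Cst s)) (Var rX)))).

Definition times16_com : com :=
  let dbl := Set_ rJJ (Add (Var rJJ) (Var rJJ)) in
  Seq (Set_ rJJ (Add (Var rJ) (Var rJ))) (Seq dbl (Seq dbl dbl)).

Definition row_com : com := For rJ 1 (Seq times16_com (Each 16 cell_com)).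

Definition copy_com : com :=
  For rJ 1 (Seq times16_com (Each 16 (fun s =>
    Put 2 (Add (Var rJJ) (Cst s)) (wget 3 (Add (Var rJJ) (Cst s)))))).

Definition dp_com : com := For rR 2 (Seq flags_com (Seq row_com copy_com)).

(** Truncated subtraction yields [k - (k - n) = minn k n], and [1 + a - b] is nonzero exactly when
    [b <= a]. *)
Definition answer_com : com :=
  Seq (Set_ rJ (Sub (Get 1 (Cst 0)) (Sub (Get 1 (Cst 0)) Sz)))
  (Seq times16_com
       (Set_ 0 (Sub (Add (Cst 1) (Add (Get 2 (Cst 0)) (wget 2 (Var rJJ))))
                    (Add (Get 3 (Cst 0)) Sz)))).

Definition cons_add_com : com := Seq bfs_com (Seq dp_com answer_com).

Lemma upd_work (m : nat -> nat) n a i b j v : a < 4 -> b < 4 ->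
  upd m (4 * (n + 1 + i) + a) v (4 * (n + 1 + j) + b) =
  if (a == b) && (i == j) then v else m (4 * (n + 1 + j) + b).
Proof.
move=> a4 b4; rewrite updE; congr (if _ then _ else _); apply/eqP/andP => [e|].
  by split; apply/eqP; lia.
by case=> /eqP -> /eqP ->.
Qed.

Lemma eval_Seq n c1 c2 s : eval n (Seq c1 c2) s = eval n c2 (eval n c1 s).
Proof. by []. Qed.

Lemma eval_Set n x e s : eval n (Set_ x e) s = setr s x (ev n s e).
Proof. by []. Qed.

Lemma eval_For n x b c s :
  eval n (For x b c) s = iteri (n + b) (fun i s' => eval n c (setr s' x i)) s.
Proof. by []. Qed.

Lemma rg_setr s x v y : rg (setr s x v) y = if y == x then v else rg s y.
Proof. by []. Qed.

Lemma times16_correct n s : rg (eval n times16_com s) rJJ = 16 * rg s rJ.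
Proof. by rewrite /= !updE /=; lia. Qed.

(** * Correctness of the search and of the dynamic program *)

Section Correct.
Variable inp : nat -> nat.
Local Notation n := (inp 0).
Hypothesis N : closed_nbhds inp.
Local Notation W s a i := (mm s (4 * (n + 1 + i) + a)).

Definition input_ok (s : store) := forall i, i < 4 * (n + 1) -> mm s i = inp i.

Lemma input_ok_eval c s : input_ok s -> input_ok (eval n c s).
Proof. by move=> h i hi; rewrite mm_input ?h. Qed.

Record queue (s : store) (l : seq nat) : Prop := Queue {
  queue_size : rg s rT = size l;
  queue_nth : forall i, i < size l -> W s 0 i = nth 0 l i;
  queue_pos : forall u, u <= n ->
    W s 1 u = if u == 0 then n + 3 else if u \in l then (index u l).+1 else 0
}.

Lemma queue_setr s l x v : x != rT -> queue s l -> queue (setr s x v) l.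
Proof. by move=> hx [h1 h2 h3]; split=> //=; rewrite updE eq_sym (negbTE hx). Qed.

(** The mark [n + 3] at entry [0] makes the single test of column 1 cover both cases in which
    [visit] leaves the queue alone. *)
Lemma queue_visit g s l : queue s l -> rg s rU <= n ->
  queue (eval n (visit_com g) s)
        (if ev n s g == 0 then visit l (rg s rU) else l).
Proof.
move=> Q hu; have [h1 h2 h3] := Q; set u := rg s rU in hu *.
rewrite /visit_com [eval _ _ _]/= -/u -/(W s 1 u) (h3 _ hu) /visit.
case: (eqVneq (ev n s g) 0) => [->|g0] /=; last first.
  by rewrite (_ : _ + _ != 0) // addn_eq0 (negbTE g0) andbF.
rewrite addn0; case: (eqVneq u 0) => [_|u0] /=; first by rewrite addn3.
case ul: (u \in l) => //; rewrite /= !updE /= h1 -/u.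
split=> /=; first by rewrite updE eqxx size_rcons addn1.
- move=> i; rewrite size_rcons ltnS => hi; rewrite !upd_work //= nth_rcons eq_sym.
  by case: ltngtP hi => // hi _; rewrite h2.
- move=> v hv; rewrite !upd_work //= h3 // mem_rcons inE [v == u]eq_sym.
  case: (eqVneq u v) => [<-|uv] /=.
    by rewrite (negbTE u0) addn1 -cats1 index_cat ul /= eqxx addn0.
  by case: eqP => // _; case: ifP => // vl; rewrite -cats1 index_cat vl.
Qed.

Lemma root_correct s l h : queue s l -> rg s rH = h -> h <= size l -> h < n ->
  uniq l -> exists2 l', queue (eval n root_com s) l' &
  size l != h /\ l' = l \/
  size l = h /\ exists2 u, 0 < u <= n /\ u \notin l & l' = rcons l u.
Proof.
move=> Q hH hl hn ul; pose I v s' := rg s' rH = h /\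
  (queue s' l /\ (size l != h \/ forall u, 0 < u <= v -> u \in l) \/
   size l = h /\ exists2 u, 0 < u <= n /\ u \notin l & queue s' (rcons l u)).
suff: I n (eval n root_com s).
  case=> _ [[Q' [h1|h1]]|[h1 [u h2 Q']]]; last first.
  - by exists (rcons l u) => //; right; split=> //; exists u.
  - exists l => //; left; split=> //; apply/negP => /eqP h2.
    (* An exhausted queue containing all [n] voters would have length [h < n]. *)
    have : size (iota 1 n) <= size l.
      apply: uniq_leq_size; first exact: iota_uniq.
      by move=> u; rewrite mem_iota => hu; apply: h1; lia.
    by rewrite size_iota h2; lia.
  - by exists l => //; left.
rewrite -[X in I X _]addn0 eval_For; apply: (iteri_ind (I := I)).
  by split=> //; left; split=> //; right => u; lia.
move=> v s1; rewrite addn0 => hv [r1 I1]; rewrite eval_Seq eval_Set.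
set s2 := setr _ rU _.
have U2 : rg s2 rU = v.+1 by rewrite rg_setr /= updE addn1.
have H2 : rg s2 rH = h by rewrite !rg_setr.
have q2 l1 : queue s1 l1 -> queue s2 l1.
  by move=> q; do 2!apply: queue_setr => //.
have E2 l1 : queue s1 l1 -> ev n s2 (Sub (Var rT) (Var rH)) = size l1 - h.
  by move=> q; rewrite -[LHS]/(rg s2 rT - rg s2 rH) H2 (queue_size (q2 _ q)).
have V2 l1 : queue s1 l1 -> queue (eval n (visit_com (Sub (Var rT) (Var rH))) s2)
    (if size l1 - h == 0 then visit l1 v.+1 else l1).
  move=> q; have := queue_visit (Sub (Var rT) (Var rH)) (q2 _ q).
  by rewrite (E2 _ q) U2; apply.
split; first by rewrite rg_frame.
case: I1 => [[q h1]|[h1 [u hu q]]]; last first.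
  right; split=> //; exists u => //; have := V2 _ q.
  by rewrite size_rcons h1 subSnn.
have := V2 _ q; rewrite subn_eq0; case: leqP => h2 q'; last first.
  by left; split=> //; left; rewrite neq_ltn h2 orbT.
have h3 : size l = h by apply/eqP; rewrite eqn_leq h2.
have e : visit l v.+1 = if v.+1 \in l then l else rcons l v.+1 by [].
move: q'; rewrite e; case vl: (v.+1 \in l) => q'; last first.
  by right; split=> //; exists v.+1; rewrite ?vl.
left; split=> //; right => w; case: h1 => [|h1]; first by rewrite h3 eqxx.
case/andP => w0; rewrite leq_eqVlt => /orP[/eqP -> //|wv]; apply: h1; lia.
Qed.

Lemma slots_correct s l h : queue s l -> rg s rH = h -> input_ok s ->
  uniq l -> h < size l -> 0 < nth 0 l h <= n ->
  queue (eval n slots_com s) (foldl visit l (nbs inp (nth 0 l h))).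
Proof.
move=> Q hH hin ul hl hx; set x := nth 0 l h in hx *.
pose I k s' := [/\ rg s' rH = h, input_ok s' &
  queue s' (foldl visit l (take k (nbs inp x)))].
suff [] : I 3 (eval n slots_com s) by [].
rewrite /slots_com eval_Each; apply: (iteri_ind (I := I)).
  by split=> //; rewrite take0.
move=> k s1 hk [h1 h2 h3]; rewrite /I.
(* Earlier visits only extend the queue, so entry [h] is still [x]. *)
have [ps [e1 _ _ _ _]] := foldl_visit (take k (nbs inp x)) ul.
rewrite eval_Seq eval_Set; set v := ev _ _ _; set s2 := setr _ _ _.
have hv : v = nth 0 (nbs inp x) k.
  rewrite /v /= h1 (queue_nth h3) e1 ?size_cat ?ltn_addr // nth_cat hl -/x.
  by rewrite h2 /nbs ?(nth_map 0) ?nth_iota ?size_iota //; lia.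
have vx : v \in nbs inp x by rewrite hv mem_nth // /nbs size_map size_iota.
rewrite (take_nth 0) ?size_map ?size_iota // -hv foldl_rcons; split.
- by rewrite rg_frame.
- exact: input_ok_eval.
- have := @queue_visit (Cst 0) s2 _ (queue_setr v (x := rU) isT h3).
  by rewrite rg_setr eqxx => /(_ (nbs_le N hx vx)).
Qed.

Lemma bfs_correct s : rg s rT = 0 -> input_ok s -> (forall u, W s 1 u = 0) ->
  exists2 l, queue (eval n bfs_com s) l & bandwidth2 inp l.
Proof.
move=> hT hin h0; rewrite /bfs_com eval_Seq; set s0 := eval _ (Put _ _ _) _.
pose I h s' := input_ok s' /\ exists2 l, queue s' l & bfs_inv inp h l.
suff [_ [l q /(bfs_bandwidth2 N) b]] :
    I n (eval n (For rH 0 (Seq root_com slots_com)) s0) by exists l.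
rewrite -[X in I X _]addn0 eval_For; apply: (iteri_ind (I := I)).
  split; first by move=> i hi; rewrite /= updE ltn_eqF ?hin //; lia.
  exists [::]; last exact: bfs_inv0.
  split=> //= u hu; rewrite upd_work //= h0 [0 == u]eq_sym.
  by case: eqP.
move=> h s1; rewrite addn0 => hn [in1 [l q b]]; rewrite eval_Seq.
set s2 := setr s1 _ _.
have q2 : queue s2 l by apply: queue_setr.
have hh : rg s2 rH = h by rewrite /= updE.
have [l' q' hl'] := root_correct q2 hh (proj1 (andP (bfs_size b))) hn (bfs_uniq b).
split; first by do 2!apply: input_ok_eval.
have ul' : uniq l'.
  case: hl' => [[_ ->]|[_ [u [_ nu] ->]]]; first exact: bfs_uniq b.
  by rewrite rcons_uniq nu (bfs_uniq b).
have sl' : {in l', forall u, 0 < u <= n}.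
  case: hl' => [[_ ->]|[_ [u [hu _] ->]]] v; first by move=> vl; apply: (bfs_sub b).
  by rewrite mem_rcons inE => /orP[/eqP -> //|vl]; apply: (bfs_sub b).
have hs : h < size l'.
  case: hl' => [[h1 ->]|[h1 [u [hu _] ->]]]; last by rewrite size_rcons h1.
  by have := bfs_size b; lia.
exists (foldl visit l' (nbs inp (nth 0 l' h))); last exact: bfs_step hl'.
apply: slots_correct => //; last by apply: sl'; apply: mem_nth.
- by rewrite rg_frame.
- exact: input_ok_eval.
Qed.

Variables (l : seq nat) (P : nat -> nat).

(** [P] describes column 1 in every row: in the first two steps the header is read as if it were a
    bundle, and its entries may exceed [n]. *)
Record ordered (s : store) : Prop := Ordered {
  ord_input : input_ok s;
  ord_nth : forall i, i < n -> W s 0 i = nth 0 l i;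
  ord_pos : forall i, W s 1 i = P i
}.

Lemma ordered_eval c s : all (fun b => 1 < b < 4) (columns c) ->
  ordered s -> ordered (eval n c s).
Proof.
move=> hc [h1 h2 h3].
have h4 : all (fun b => b < 4) (columns c) by apply: sub_all hc => b /andP[].
have nin a : a < 2 -> a \notin columns c.
  by move=> a2; apply/negP => /(allP hc); lia.
split; first exact: input_ok_eval.
- by move=> i hi; rewrite mm_column ?nin ?h2.
- by move=> i; rewrite mm_column ?nin ?h3.
Qed.

Lemma ordered_setr s x v : ordered s -> ordered (setr s x v).
Proof. by case=> h1 h2 h3; split. Qed.

Hypothesis B : bandwidth2 inp l.
Hypothesis P0 : P 0 = n + 3.
Hypothesis Pidx : forall u, 0 < u <= n -> P u = (index u l).+1.

Definition pick (s : store) (w : nat) : nat :=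
  if ev n s (flag_sum w (iota 0 5)) != 0 then rg s rCov else rg s rUnc.

Lemma flag_sum_neq0 s w ks : (ev n s (flag_sum w ks) != 0) =
  has (fun k => bit k w && (rg s (rFlag k) != 0)) ks.
Proof.
elim: ks => //= k ks <-; case: (bit k w) => //=.
by rewrite addn_eq0 negb_and.
Qed.

Lemma differ_neq0 s e1 e2 :
  (ev n s (differ e1 e2) != 0) = (ev n s e1 != ev n s e2).
Proof. by rewrite /= addn_eq0 !subn_eq0 -eqn_leq. Qed.

Lemma eval_If e c1 c2 s : eval n (If e c1 c2) s =
  if ev n s e != 0 then eval n c1 s else eval n c2 s.
Proof. by []. Qed.

Lemma flag_correct k s c i : k < 5 -> ordered s -> rg s rC = c -> rg s rI = i ->
  c <= n -> (rg (eval n (flag_com k) s) (rFlag k) != 0) =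
    has (fun v => P v + k == i) (nbs inp c).
Proof.
move=> k5 O hc hi cn; rewrite /flag_com eval_Seq eval_Set eval_Each.
pose I a s' := [/\ ordered s', rg s' rC = c, rg s' rI = i &
  (rg s' (rFlag k) != 0) = has (fun v => P v + k == i) (take a (nbs inp c))].
suff [] : I 3 (iteri 3 (fun a => eval n (If (differ (Add (wget 1 (Get a.+1 (Var rC)))
  (Cst k)) (Var rI)) Skip (Set_ (rFlag k) (Cst 1)))) (setr s (rFlag k) 0)) by [].
apply: (iteri_ind (I := I)).
  split; first exact: ordered_setr.
  - by rewrite rg_setr.
  - by rewrite rg_setr.
  - by rewrite rg_setr eqxx take0.
move=> a s1 a3 [h1 h2 h3 h4].
have hv : ev n s1 (Get a.+1 (Var rC)) = nth 0 (nbs inp c) a.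
  rewrite /= h2 (ord_input h1) /nbs ?(nth_map 0) ?nth_iota ?size_iota //; lia.
rewrite /I (take_nth 0) ?size_map ?size_iota // -hv has_rcons.
rewrite eval_If differ_neq0.
have -> : ev n s1 (Add (wget 1 (Get a.+1 (Var rC))) (Cst k)) =
    P (ev n s1 (Get a.+1 (Var rC))) + k by rewrite -(ord_pos h1).
rewrite [ev _ _ (Var rI)]/= h3; case: eqP => [e|ne] /=; last by split.
split; first exact: ordered_setr.
- by rewrite updE.
- by rewrite updE.
- by rewrite updE eqxx.
Qed.

Lemma center_correct s r : ordered s -> rg s rR = r -> r < n + 2 ->
  let s' := eval n center_com s in
  [/\ rg s' rI = n + 2 - r, rg s' rC <= n &
   if n + 2 - r <= 2 then rg s' rCov = 0 /\ rg s' rUnc = 0 else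
   [/\ rg s' rC = nth 0 l (n + 2 - r - 3),
       rg s' rCov = 2 * inp (4 * rg s' rC) & rg s' rUnc = 1]].
Proof.
move=> O hr rn; rewrite /center_com eval_Seq eval_Set.
have -> : ev n s (Sub (Add Sz (Cst 2)) (Var rR)) = n + 2 - r by rewrite /= hr.
set i := n + 2 - r; rewrite eval_If.
have -> : ev n (setr s rI i) (Sub (Var rI) (Cst 2)) = i - 2 by [].
rewrite subn_eq0; case: leqP => h /=; rewrite ?updE /=; first by split.
have -> : mm s (4 * (n + 1 + (i - 3)) + 0) = nth 0 l (i - 3).
  by rewrite (ord_nth O) //; lia.
have hl : nth 0 l (i - 3) \in l.
  by apply: mem_nth; rewrite (perm_size (bw_perm B)) size_iota; lia.
have {}hl : nth 0 l (i - 3) <= n.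
  by move: hl; rewrite (perm_mem (bw_perm B)) mem_iota; lia.
split=> //; split=> //.
rewrite (ord_input O); last by lia.
by rewrite addn0 mul2n addnn.
Qed.

Lemma flags_correct s r : ordered s -> rg s rR = r -> r < n + 2 ->
  forall w, pick (eval n flags_com s) w = gain inp l P (n + 2 - r) w.
Proof.
move=> O hr rn w; rewrite /flags_com eval_Seq; have := center_correct O hr rn.
have O1 : ordered (eval n center_com s) by exact: ordered_eval.
set s1 := eval n center_com s in O1 *; set i := n + 2 - r.
case=> hI hC hcu.
pose I k s' := [/\ ordered s', rg s' rI = i, rg s' rC = rg s1 rC,
  rg s' rCov = rg s1 rCov /\ rg s' rUnc = rg s1 rUnc & forall k', k' < k ->
  (rg s' (rFlag k') != 0) = has (fun v => P v + k' == i) (nbs inp (rg s1 rC))].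
have : I 5 (eval n (Each 5 flag_com) s1).
  rewrite eval_Each; apply: (iteri_ind (I := I)); first by split.
  move=> k s2 k5 [h1 h2 h3 [h4 h5] h6].
  have fr x : x < 20 -> rg (eval n (flag_com k) s2) x = rg s2 x.
    by move=> x20; rewrite rg_frame //= !inE; lia.
  split; rewrite ?fr //; first exact: ordered_eval.
  move=> k'; rewrite ltnS leq_eqVlt => /orP[/eqP ->|hk].
    by apply: flag_correct => //; rewrite h3.
  rewrite rg_frame ?h6 //= !inE; lia.
set s2 := eval n (Each _ _) _; case=> _ _ _ [h4 h5] h6.
rewrite /pick h4 h5 flag_sum_neq0 /gain.
(* In the first two steps both gains are [0], so the value is [0] for any flags. *)
case: leqP hcu => hi; first by case=> -> ->; case: ifP.
case=> e1 -> ->; rewrite -e1 /hit.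
congr (if _ then _ else _); apply: eq_in_has => k; rewrite mem_iota => hk.
by rewrite h6.
Qed.

Lemma pick_setr s x v w : x < 20 -> x != rCov -> x != rUnc ->
  pick (setr s x v) w = pick s w.
Proof.
move=> hx h1 h2; rewrite /pick !flag_sum_neq0 !rg_setr eq_sym (negbTE h1).
rewrite eq_sym (negbTE h2); congr (if _ then _ else _); apply: eq_in_has => k _.
rewrite rg_setr (_ : (rFlag k == x) = false) //; apply/eqP; lia.
Qed.

Lemma pick_eval c s w :
  [/\ rCov \notin assigned c, rUnc \notin assigned c &
     forall k, k < 5 -> rFlag k \notin assigned c] ->
  pick (eval n c s) w = pick s w.
Proof.
case=> h1 h2 h3; rewrite /pick !flag_sum_neq0 !rg_frame //.
congr (if _ then _ else _); apply: eq_in_has => k; rewrite mem_iota => hk.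
by rewrite rg_frame // h3.
Qed.
Local Notation g := (gain inp l P).
Local Notation M := (n + 2).

Record dp_state (s : store) (r : nat) : Prop := DpState {
  dp_ordered : ordered s;
  dp_table : forall j k, j <= n -> k < 16 -> W s 2 (16 * j + k) = best g M r k j
}.

Lemma dp_state_setr s r x v : dp_state s r -> dp_state (setr s x v) r.
Proof. by case=> h1 h2; split=> //; exact: ordered_setr. Qed.

Lemma dp_state_eval c s r : all (fun b => b == 3) (columns c) ->
  dp_state s r -> dp_state (eval n c s) r.
Proof.
move=> hc [h1 h2]; split.
  by apply: ordered_eval => //; apply: sub_all hc => b /eqP ->.
move=> j k hj hk; rewrite mm_column ?h2 //.
  by apply: sub_all hc => b /eqP ->.
by apply/negP => /(allP hc).
Qed.

Lemma eval_gain_com x w s : eval n (gain_com x w) s = setr s x (pick s w).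
Proof. by rewrite /gain_com eval_If /pick; case: ifP. Qed.

Lemma cell_correct k s r j : dp_state s r -> k < 16 -> rg s rJ = j ->
  rg s rJJ = 16 * j -> j <= n -> (forall w, pick s w = g (M - r) w) ->
  forall i, W (eval n (cell_com k) s) 3 i =
    if i == 16 * j + k then best g M r.+1 k j else W s 3 i.
Proof.
move=> D hk hj hjj jn hp i; rewrite /cell_com !eval_Seq eval_gain_com eval_Set hp.
have T b j' : j' <= n -> W s 2 (16 * j' + b %% 16) = best g M r (b %% 16) j'.
  by move=> hj'; rewrite (dp_table D) // ltn_mod.
set v1 := g (M - r) (2 * k) + best g M r ((2 * k) %% 16) j.
have -> : ev n (setr s rX (g (M - r) (2 * k))) (Add (Var rX)
    (wget 2 (Add (Var rJJ) (Cst ((2 * k) %% 16))))) = v1.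
  by rewrite /= !updE /= hjj T.
set s1 := setr (setr _ _ _) _ _.
set s2 := eval n (If (Var rJ) _ _) s1.
suff [e1 e2 e3] : [/\ mm s2 = mm s, rg s2 rJJ = 16 * j & rg s2 rX = best g M r.+1 k j].
  rewrite /= e1 e2 e3 upd_work //= eq_sym; by case: eqP.
have s1J : rg s1 rJ = j by [].
have s1JJ : rg s1 rJJ = 16 * j by [].
have s1M : mm s1 = mm s by [].
have s1X : rg s1 rX = v1 by [].
have s1P w : pick s1 w = g (M - r) w by rewrite !pick_setr.
have -> : best g M r.+1 k j = maxn v1 (if j is j'.+1
    then g (M - r) (2 * k + 1) + best g M r ((2 * k + 1) %% 16) j' else 0) by [].
rewrite /s2 eval_If (_ : ev n s1 (Var rJ) = j) //.
clearbody s1 v1; clear s2.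
case: j hjj jn s1J s1JJ {hj} => [|j'] hjj jn s1J s1JJ.
  by rewrite maxn0.
rewrite [_ != 0]/= !eval_Seq eval_gain_com s1P eval_Set.
set v2 := ev _ _ _.
have <- : v2 = g (M - r) (2 * k + 1) + best g M r ((2 * k + 1) %% 16) j'.
  by rewrite /v2 /= !updE /= s1JJ s1M mulnS addKn T // ltnW.
set s3 := setr (setr s1 _ _) _ _.
rewrite eval_If (_ : ev n s3 (Sub (Var rY) (Var rX)) = v2 - v1); last first.
  by rewrite /= !updE /= s1X.
rewrite subn_eq0; by case: leqP => h; split.
Qed.

(** Two nested invariants, over budgets and over states; the current table survives because only
    column 3 is written. *)
Lemma row_correct s r : dp_state s r ->
  (forall w, pick s w = g (M - r) w) ->
  let s' := eval n row_com s in dp_state s' r /\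
  forall j k, j <= n -> k < 16 -> W s' 3 (16 * j + k) = best g M r.+1 k j.
Proof.
move=> D hp s'.
pose I j s1 := [/\ dp_state s1 r, forall w, pick s1 w = g (M - r) w &
  forall j' k, j' < j -> k < 16 -> W s1 3 (16 * j' + k) = best g M r.+1 k j'].
suff [h1 _ h3] : I (n + 1) s'.
  by split=> // j k hj hk; apply: h3; rewrite // addn1.
rewrite /s' eval_For; apply: (iteri_ind (I := I)); first by split.
move=> j s1 hj [h1 h2 h3]; rewrite eval_Seq eval_Each.
set s2 := eval n times16_com _.
pose K k s3 := [/\ dp_state s3 r, forall w, pick s3 w = g (M - r) w,
  rg s3 rJ = j /\ rg s3 rJJ = 16 * j,
  forall j' k, j' < j -> k < 16 -> W s3 3 (16 * j' + k) = best g M r.+1 k j' &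
  forall k', k' < k -> W s3 3 (16 * j + k') = best g M r.+1 k' j].
suff [k1 k2 _ k3 k4] : K 16 (iteri 16 (fun k => eval n (cell_com k)) s2).
  split=> // j' k; rewrite ltnS leq_eqVlt => /orP[/eqP ->|]; [exact: k4|exact: k3].
apply: (iteri_ind (I := K)).
  split=> //.
  - by apply: dp_state_eval => //; apply: dp_state_setr.
  - move=> w; rewrite pick_eval // pick_setr //.
  - by rewrite times16_correct rg_frame.
move=> k s3 hk [k1 k2 [k3 k3'] k4 k5].
have jn : j <= n by rewrite addn1 ltnS in hj.
have C := cell_correct k1 hk k3 k3' jn k2; split.
- exact: dp_state_eval.
- by move=> w; rewrite pick_eval.
- by rewrite !rg_frame.
- move=> j' k' hj' hk'; rewrite C k4 //.
  by case: eqP => // e; lia.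
- move=> k'; rewrite C ltnS eqn_add2l leq_eqVlt; case: eqP => [-> //|_] /=.
  exact: k5.
Qed.

Lemma copy_correct s r : dp_state s r ->
  (forall j k, j <= n -> k < 16 -> W s 3 (16 * j + k) = best g M r.+1 k j) ->
  dp_state (eval n copy_com s) r.+1.
Proof.
move=> D h3.
pose I j s1 := [/\ ordered s1,
  forall j k, j <= n -> k < 16 -> W s1 3 (16 * j + k) = best g M r.+1 k j &
  forall j' k, j' < j -> k < 16 -> W s1 2 (16 * j' + k) = best g M r.+1 k j'].
suff [h1 _ h2] : I (n + 1) (eval n copy_com s).
  by split=> // j k hj hk; apply: h2; rewrite // addn1.
rewrite eval_For; apply: (iteri_ind (I := I)); first by split=> //; exact: dp_ordered D.
move=> j s1 hj [h1 {}h3 h2]; rewrite eval_Seq eval_Each.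
set s2 := eval n times16_com _.
have jn : j <= n by rewrite addn1 ltnS in hj.
pose K k s3 := [/\ ordered s3,
  forall j k, j <= n -> k < 16 -> W s3 3 (16 * j + k) = best g M r.+1 k j,
  rg s3 rJJ = 16 * j,
  forall j' k, j' < j -> k < 16 -> W s3 2 (16 * j' + k) = best g M r.+1 k j' &
  forall k', k' < k -> W s3 2 (16 * j + k') = best g M r.+1 k' j].
suff [k1 k2 _ k3 k4] : K 16 (iteri 16 (fun k => eval n (Put 2
    (Add (Var rJJ) (Cst k)) (wget 3 (Add (Var rJJ) (Cst k))))) s2).
  split=> // j' k; rewrite ltnS leq_eqVlt => /orP[/eqP ->|]; [exact: k4|exact: k3].
apply: (iteri_ind (I := K)).
  split=> //; last by rewrite times16_correct.
  by apply: ordered_eval => //; apply: ordered_setr.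
move=> k s3 hk [k1 k2 k3 k4 k5].
have E a i : a < 4 -> W (eval n (Put 2 (Add (Var rJJ) (Cst k))
    (wget 3 (Add (Var rJJ) (Cst k)))) s3) a i =
    if (2 == a) && (16 * j + k == i) then best g M r.+1 k j else W s3 a i.
  by move=> a4; rewrite /= k3 upd_work // k2.
split=> //.
- exact: ordered_eval.
- by move=> j' k' hj' hk'; rewrite E //= k2.
- by move=> j' k' hj' hk'; rewrite E //= k4 //; case: eqP => // e; lia.
- move=> k'; rewrite E // ltnS eqn_add2l leq_eqVlt eq_sym; case: eqP => [-> //|_] /=.
  exact: k5.
Qed.

(** Zeroed memory is already the table of [best] for no remaining steps. *)
Lemma dp_correct s : ordered s -> (forall i, W s 2 i = 0) ->
  dp_state (eval n dp_com s) M.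
Proof.
move=> O h2; rewrite /dp_com eval_For; apply: (iteri_ind (I := fun r s => dp_state s r)).
  by split.
move=> r s1 rn D; rewrite 2!eval_Seq.
set s2 := setr s1 rR r; have D2 : dp_state s2 r by apply: dp_state_setr.
have p := @flags_correct s2 r (dp_ordered D2) erefl rn.
have D3 : dp_state (eval n flags_com s2) r by exact: dp_state_eval.
have [D4 T] := row_correct D3 p.
by apply: copy_correct; [exact: D4 | exact: T].
Qed.
End Correct.

Lemma cons_add_correct inp : closed_nbhds inp ->
  (forall i, 4 * (inp 0 + 1) <= i -> inp i = 0) ->
  rg (eval (inp 0) cons_add_com (Store (fun=> 0) inp)) 0 != 0 <->
  exists chosen, count chosen (iota 1 (inp 0)) <= inp 1 /\
    inp 3 + inp 0 <= inp 2 + value inp chosen.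
Proof.
move=> N h0; set n := inp 0; set s0 := Store _ inp.
have in0 : input_ok inp s0 by [].
have w0 a i : mm s0 (4 * (n + 1 + i) + a) = 0.
  by rewrite /= h0 //; lia.
have [l Q B] := @bfs_correct inp N s0 erefl in0 (w0 1).
rewrite /cons_add_com 2!eval_Seq; set s1 := eval n bfs_com s0 in Q *.
pose P u := mm s1 (4 * (n + 1 + u) + 1).
have O1 : ordered inp l P s1.
  split=> //; first exact: input_ok_eval.
  move=> i hi; apply: (queue_nth Q).
  by rewrite (perm_size (bw_perm B)) size_iota.
have P0 : P 0 = n + 3 by rewrite /P (queue_pos Q).
have Pi u : 0 < u <= n -> P u = (index u l).+1.
  move=> hu; have [u0 un] := andP hu; rewrite /P (queue_pos Q) // eqn0Ngt u0 /=.
  by rewrite (perm_mem (bw_perm B)) mem_iota add1n ltnS hu.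
have D : dp_state inp l P (eval n dp_com s1) (n + 2).
  (* The search writes columns 0 and 1 only, so column 2 is still zero. *)
  by apply: dp_correct => // i; rewrite mm_column // w0.
set s2 := eval n dp_com s1 in D *; have in2 := ord_input (dp_ordered D).
pose kk := minn (inp 1) n.
have kn : kk <= n by exact: geq_minr.
have -> : rg (eval n answer_com s2) 0 =
    1 + (inp 2 + best (gain inp l P) (n + 2) (n + 2) 0 kk) - (inp 3 + n).
  rewrite /answer_com 2!eval_Seq (eval_Set _ rJ).
  have -> : ev n s2 (Sub (Get 1 (Cst 0)) (Sub (Get 1 (Cst 0)) Sz)) = kk.
    rewrite /= in2; last by lia.
    by rewrite muln0 add0n /kk /minn /n; case: ltnP; lia.
  set s3 := eval n times16_com _.
  have e3 : rg s3 rJJ = 16 * kk by rewrite times16_correct.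
  have m3 : mm s3 = mm s2 by [].
  clearbody s3.
  rewrite eval_Set rg_setr eqxx [ev _ _ _]/= m3 e3 !muln0 !add0n.
  have i4 i : i < 4 -> i < 4 * (n + 1) by lia.
  have := dp_table D (k := 0) kn isT; rewrite addn0 => ->.
  by rewrite !in2 ?i4.
rewrite subn_eq0 -ltnNge ltnS -leq_subLR.
rewrite (best_value N _ B P0 Pi).
by split=> -[ch [h1 h2]]; exists ch; move: h2; rewrite leq_subLR.
Qed.

(** * The encoded election *)

Section Encoding.
Variables (C Vt : finType) (fav : Vt -> C) (V W : {set Vt}).
Variables (kappa : Vt -> {set Vt}) (p : C) (k : nat).
Hypothesis C2 : #|C| = 2.
Hypothesis VW : [disjoint V & W].
Hypothesis kappaW : bundling_on W kappa.
Hypothesis kappa_sym : symmetric_bundling W kappa.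
Hypothesis kappa3 : max_bundle_size_le W kappa 3.

Local Notation ws := (enum W).
Local Notation enc := (encode fav V W kappa p k).

Definition voter_id (x : Vt) : nat := (index x ws).+1.

Lemma encode0 : enc 0 = #|W|.
Proof. by rewrite /encode /= -cardE. Qed.

Lemma index_enum x : x \in W -> index x ws < #|W|.
Proof. by move=> xW; rewrite cardE index_mem mem_enum. Qed.

Lemma voter_id_bound x : x \in W -> 0 < voter_id x <= enc 0.
Proof. by move=> xW; rewrite encode0 index_enum. Qed.

Lemma encode_row x a : x \in W -> a < 4 -> enc (4 * voter_id x + a) =
  if a == 0 then (fav x == p) : nat
  else nth 0 [seq voter_id y | y <- enum (kappa x)] a.-1.
Proof.
move=> xW a4; have hx := index_enum xW; rewrite cardE in hx.
rewrite /encode /voter_id; set i := index x ws in hx *.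
have -> : 4 * i.+1 + a - 4 = i * 4 + a by lia.
rewrite divnMDl // divn_small // addn0 modnMDl modn_small // hx.
have ne b : b < 4 -> (4 * i.+1 + a == b) = false by move=> b4; apply/eqP; lia.
rewrite !ne // (nth_map x) // (nth_map x) // /i nth_index ?mem_enum //.
Qed.

(** The size bound three ensures that the three slots hold the whole bundle, followed by zeros. *)
Lemma mem_nbs x v : x \in W ->
  (v != 0) && (v \in nbs enc (voter_id x)) = (v \in map voter_id (enum (kappa x))).
Proof.
move=> xW; set b := map _ _.
have sb : size b <= 3 by rewrite size_map -cardE kappa3.
have -> : nbs enc (voter_id x) = mkseq (nth 0 b) 3.
  by apply/eq_in_map => a; rewrite mem_iota => ha; rewrite encode_row //; lia.
apply/andP/idP => [[v0 /mapP[a _ ev]]|vb].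
  rewrite ev mem_nth //; case: (ltnP a (size b)) => // ha.
  by rewrite ev nth_default ?eqxx in v0.
split; first by case/mapP: vb => y _ ->.
apply/mapP; exists (index v b); last by rewrite nth_index.
by rewrite mem_iota; apply: leq_trans sb; rewrite index_mem.
Qed.

Lemma voter_of_id u : 0 < u <= enc 0 -> exists2 x, x \in W & u = voter_id x.
Proof.
rewrite encode0 cardE => /andP[u0 un]; case: u u0 un => // u _ un.
have x0 : Vt by case: (enum W) un.
exists (nth x0 ws u); first by rewrite -mem_enum mem_nth.
by rewrite /voter_id index_uniq // enum_uniq.
Qed.

Lemma voter_id_inj : {in W &, injective voter_id}.
Proof.
move=> x y xW yW [e].
by rewrite -(nth_index x (s := ws) (x := x)) ?mem_enum // e nth_index ?mem_enum.
Qed.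

Lemma mem_nbs_id x y : x \in W -> y \in W ->
  (voter_id y \in nbs enc (voter_id x)) = (y \in kappa x).
Proof.
move=> xW yW; rewrite -[LHS]andTb -[true]/(voter_id y != 0) mem_nbs //.
apply/mapP/idP => [[z]|yx]; last by exists y; rewrite ?mem_enum.
rewrite mem_enum => zx /voter_id_inj -> //.
by apply: (subsetP (kappaW xW).2).
Qed.

Lemma encode_closed : closed_nbhds enc.
Proof.
split.
- move=> u v /voter_of_id[x xW ->] vx; case: (eqVneq v 0) => [-> //|v0].
  have : v \in map voter_id (enum (kappa x)) by rewrite -mem_nbs // v0.
  case/mapP => y; rewrite mem_enum => yx ->.
  by have /andP[] := voter_id_bound (subsetP (kappaW xW).2 _ yx).
- by move=> u /voter_of_id[x xW ->]; rewrite mem_nbs_id //; case: (kappaW xW).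
- move=> u v /voter_of_id[x xW ->] /voter_of_id[y yW ->]; rewrite !mem_nbs_id //.
  by case: (eqVneq x y) => [-> //|xy] yx; apply/(kappa_sym xW yW xy).
Qed.

Lemma encode_zero i : 4 * (enc 0 + 1) <= i -> enc i = 0.
Proof.
rewrite encode0 cardE => hi; rewrite /encode.
have ne b : b < 4 -> (i == b) = false by move=> b4; apply/eqP; lia.
rewrite !ne // ifF //; apply/negbTE; rewrite -leqNgt leq_divRL //; lia.
Qed.

Lemma iota_voter_id : iota 1 (enc 0) = map voter_id ws.
Proof.
apply: (@eq_from_nth _ 0) => [|i]; first by rewrite size_iota size_map encode0 cardE.
rewrite size_iota => hi; rewrite nth_iota //; move: hi; rewrite encode0 cardE => hi.
have x0 : Vt by case: (enum W) hi.
by rewrite (nth_map x0) // /voter_id index_uniq ?enum_uniq.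
Qed.

Section Chosen.
Variables (chosen : nat -> bool) (W' : {set Vt}).
Hypothesis W'W : W' \subset W.
Hypothesis chosenE : forall x, x \in W -> chosen (voter_id x) = (x \in W').
Local Notation U := (bundle_union kappa W').

Lemma count_chosen : count chosen (iota 1 (enc 0)) = #|W'|.
Proof.
rewrite iota_voter_id count_map -sum1_count big_enum_cond -sum1_card.
apply: eq_bigl => x; case xW: (x \in W); first by rewrite /= chosenE.
by apply/esym/negbTE/negP => /(subsetP W'W); rewrite xW.
Qed.

Lemma bundle_union_sub : U \subset W.
Proof.
by apply/bigcupsP => w wW'; case: (kappaW (subsetP W'W _ wW')).
Qed.

(** Symmetry turns lying in the bundle of a chosen voter into having a chosen voter in one's own
    bundle; the case of equal voters is separate, as symmetry is stated for distinct ones. *)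
Lemma covered x : x \in W ->
  has (fun v => (v != 0) && chosen v) (nbs enc (voter_id x)) = (x \in U).
Proof.
move=> xW; apply/hasP/bigcupP => [[v vx /andP[v0 cv]]|[y yW' xy]].
  have : v \in map voter_id (enum (kappa x)) by rewrite -mem_nbs // v0.
  case/mapP => y; rewrite mem_enum => yx ev.
  have yW := subsetP (kappaW xW).2 _ yx.
  exists y; first by rewrite -chosenE // -ev.
  by case: (eqVneq x y) yx => [-> //|xy] yx; apply/(kappa_sym xW yW xy).
have yW := subsetP W'W _ yW'; exists (voter_id y); last by rewrite chosenE.
rewrite mem_nbs_id //.
by case: (eqVneq y x) xy => [-> //|yx] xy; apply/(kappa_sym yW xW yx).
Qed.

(** Covered supporters contribute [2] each and the voters outside [U] contribute [1] each. With two
    candidates, [2 * score fav p U - #|U|] is the lead gained by [p]. *)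
Lemma value_chosen : value enc chosen + #|U| = #|W| + 2 * score fav p U.
Proof.
rewrite /value iota_voter_id big_map big_enum /=.
have -> : \sum_(x in W) (if has (fun v => (v != 0) && chosen v) (nbs enc (voter_id x))
      then 2 * enc (4 * voter_id x) else 1) =
   \sum_(x in W) (if x \in U then 2 * (fav x == p) else 1).
  apply: eq_bigr => x xW; rewrite covered //.
  by rewrite -(addn0 (4 * _)) encode_row.
rewrite (big_setID U) /= (setIidPr bundle_union_sub).
rewrite (eq_bigr (fun x => 2 * (fav x == p))); last by move=> x ->.
have -> : \sum_(x in W :\: U) (if x \in U then 2 * (fav x == p) else 1) = #|W :\: U|.
  by rewrite -sum1_card; apply: eq_bigr => x; rewrite inE => /andP[/negbTE ->].
rewrite -big_distrr /= -(cardsID U W) (setIidPr bundle_union_sub).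
have -> : score fav p U = \sum_(x in U) (fav x == p).
  by rewrite /score -sum1_card big_mkcond [RHS]big_mkcond /=; apply: eq_bigr => x _;
    rewrite inE; case: (x \in U); case: (fav x == p).
lia.
Qed.
End Chosen.

(** * Plurality with two candidates *)

Lemma score_disjoint c (X Y : {set Vt}) : [disjoint X & Y] ->
  score fav c (X :|: Y) = score fav c X + score fav c Y.
Proof.
move=> XY; rewrite /score -cardsUI [X in _ = _ + X]eq_card0 ?addn0.
  by apply: eq_card => x; rewrite !inE andb_orl.
move=> x; rewrite !inE; apply/negP => /andP[/andP[xX _] /andP[xY _]].
by move: XY => /disjointFr/(_ xX); rewrite xY.
Qed.

Lemma other_candidate : exists q, forall c, (c != p) = (c == q).
Proof.
have [q qE] := mem_card1 (etrans (cardC1 p) (congr1 predn C2)).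
by exists q => c; have := qE c; rewrite !inE.
Qed.

Lemma plurality_two (X : {set Vt}) :
  plurality_winner fav X p <-> #|X| <= 2 * score fav p X.
Proof.
have [q qE] := other_candidate.
have sq : score fav p X + score fav q X = #|X|.
  rewrite -(cardsID [set x | fav x == p] X); congr (_ + _).
    by apply: eq_card => x; rewrite !inE.
  by apply: eq_card => x; rewrite !inE qE andbC.
split=> [/(_ q)|h c]; first by lia.
case: (eqVneq c p) => [-> //|]; rewrite qE => /eqP ->; lia.
Qed.

Lemma CConsAdd_value :
  (exists chosen, count chosen (iota 1 (enc 0)) <= enc 1 /\
     enc 3 + enc 0 <= enc 2 + value enc chosen) <->
  CConsAdd fav V W kappa p k.
Proof.
have win ch (W' : {set Vt}) : W' \subset W ->
    (forall x, x \in W -> ch (voter_id x) = (x \in W')) ->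
    enc 3 + enc 0 <= enc 2 + value enc ch <->
    plurality_winner fav (V :|: bundle_union kappa W') p.
  move=> W'W chE; have hv := value_chosen W'W chE.
  have dj : [disjoint V & bundle_union kappa W'].
    exact: disjointWr (bundle_union_sub W'W) VW.
  rewrite plurality_two score_disjoint // cardsU disjoint_setI0 // cards0 subn0.
  (* Makes the truncated subtraction in cell [3] exact. *)
  have sV : score fav p V <= #|V|.
    by apply: subset_leq_card; apply/subsetP => x; rewrite inE => /andP[].
  have -> : enc 3 = #|V| - score fav p V by [].
  have -> : enc 2 = score fav p V by [].
  rewrite encode0; lia.
split=> [[ch [hk ht]]|[W' [W'W hk hw]]].
  pose W' := [set x in W | ch (voter_id x)].
  have W'W : W' \subset W by apply/subsetP => x; rewrite inE => /andP[].
  have chE x : x \in W -> ch (voter_id x) = (x \in W') by rewrite inE => ->.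
  exists W'; split=> //; first by rewrite -(count_chosen W'W chE).
  exact/(win ch).
pose ch u := u \in map voter_id (enum W').
have chE x : x \in W -> ch (voter_id x) = (x \in W').
  move=> xW; apply/mapP/idP => [[y]|xW']; last by exists x; rewrite ?mem_enum.
  rewrite mem_enum => yW' /voter_id_inj -> //; exact: (subsetP W'W).
exists ch; split; first by rewrite (count_chosen W'W chE).
exact/(win ch W').
Qed.
End Encoding.

Theorem theorem2 :
  exists (P : seq instr) (c : nat),
  forall (C Vt : finType) (fav : Vt -> C) (V W : {set Vt})
         (kappa : Vt -> {set Vt}) (p : C) (k : nat),
    #|C| = 2 ->
    [disjoint V & W] ->
    bundling_on W kappa ->
    symmetric_bundling W kappa ->
    max_bundle_size_le W kappa 3 ->
    ram_decides_within P (encode fav V W kappa p k)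
      (c * #|W| ^ 5 + c) (CConsAdd fav V W kappa p k).
Proof.
have [K HK] := cost_bound cons_add_com.
(* Loop depth two gives cost at most [K * n.+1 ^ 2], and [n.+1 ^ 2 <= 4 * (n ^ 5 + 1)] for every
   [n]. *)
exists (ccom cons_add_com 0 0), (K * 4) => C Vt fav V W kappa p k C2 VW kW ks k3.
apply: (ram_decides_com (n := #|W|)).
- exact: encode0.
- apply: leq_trans (HK _) _; rewrite -mulnSr -mulnA leq_mul2l; apply/orP; right.
  rewrite (_ : depth cons_add_com = 2) //.
  case: #|W| => // n; rewrite !expnS expn0; nia.
- rewrite -(CConsAdd_value fav p k C2 VW kW ks k3).
  rewrite -{1}(encode0 fav V W kappa p k).
  apply: cons_add_correct; first exact: encode_closed.
  by move=> i; apply: encode_zero.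
Qed.
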